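(* Let $a_0,a_1,b_1\in\mathbb{R}$ and $p(t)=a_0+a_1\cos t+b_1\sin t$, and assume that $$a_1^2+b_1^2>\frac{9a_0^2}{4\,(J_1(1)-J_2(1))^2}.$$ Then the equation $$\ddot x+1-\frac{1}{\sqrt{2x+1}}=\varepsilon p(t)$$ is resonant on compact subsets, that is: for every compact subset $\mathcal{K}\subset\mathscr{P}$ with non-empty interior and every $d>0$ there exists $\varepsilon^*>0$ such that, if $0<|\varepsilon|<\varepsilon^*$, then every open ball $B\subset\mathcal{K}$ of diameter $d$ satisfies $\varphi_\varepsilon(t,B)\not\subset\mathcal{K}$ for some time $t>0$.
   Context: $J_\nu$ denotes the Bessel function of the first kind of order $\nu$. The unperturbed equation ($\varepsilon=0$) is $\ddot x+V'(x)=0$ with $V(x)=1+x-\sqrt{2x+1}$ on $I=(-\tfrac12,\tfrac32)$; it has an isochronous center at the origin with maximum energy level $\overline{V}=\tfrac12$. Its period annulus is $\mathscr{P}=\{(x,y)\in I\times\mathbb{R}: \tfrac12y^2+V(x)<\tfrac12\}$ (including the equilibrium at the origin). For $\varepsilon\in\mathbb{R}$ and $\mathbf{x}\in\mathscr{P}$, $\varphi_\varepsilon(t,\mathbf{x})$ denotes the solution at time $t$ of the system $\dot x=y$, $\dot y=-1+\frac{1}{\sqrt{2x+1}}+\varepsilon p(t)$ with value $\mathbf{x}=(x,\dot x)$ at $t=0$, and $\varphi_\varepsilon(t,\mathcal{U})=\{\varphi_\varepsilon(t,\mathbf{x}):\mathbf{x}\in\mathcal{U}\}$. The assertion $\varphi_\varepsilon(t,B)\not\subset\mathcal{K}$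 for some $t>0$ means: there are $t>0$ and $\mathbf{x}\in B$ such that the solution starting at $\mathbf{x}$ is defined on $[0,t]$ and $\varphi_\varepsilon(t,\mathbf{x})\notin\mathcal{K}$. *)

(* Defs.v *)
From Stdlib Require Import Reals Factorial List.
From Coquelicot Require Import Coquelicot.
Open Scope R_scope.

(* Bessel function of the first kind; for an integer order n the usual
   Gamma (m + n + 1) is (m + n)!. *)
Definition BesselJ (n : nat) (x : R) : R :=
  Series (fun m : nat =>
    (-1) ^ m / (INR (fact m) * INR (fact (m + n))) * (x / 2) ^ (2 * m + n)).

Definition V (x : R) : R := 1 + x - sqrt (2 * x + 1).

Definition period_annulus (z : R * R) : Prop :=
  -1 / 2 < fst z < 3 / 2 /\ (snd z) ^ 2 / 2 + V (fst z) < 1 / 2.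

(* Compactness by open covers: Coquelicot has no such predicate for subsets
   of a general uniform space. *)
Definition compact_set {T : UniformSpace} (K : T -> Prop) : Prop :=
  forall (I : Type) (U : I -> T -> Prop),
    (forall i : I, open (U i)) ->
    (forall z : T, K z -> exists i : I, U i z) ->
    exists l : list I, forall z : T, K z -> exists i : I, In i l /\ U i z.

Definition nonempty_interior {T : UniformSpace} (K : T -> Prop) : Prop :=
  exists z : T, locally z K.

(* Euclidean: Coquelicot's [ball] on R * R is the one of the sup distance. *)
Definition open_disc (c : R * R) (r : R) (z : R * R) : Prop :=
  dist_euc (fst z) (snd z) (fst c) (snd c) < r.

(* [-1/2 < x s] keeps the solution in the domain of the vector field, since
   [sqrt] and [/] are total.  The derivatives are two-sided also at 0 and t:
   this loses no solution on [0, t], as the domain of the (smooth) vector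
   field is open and solutions extend past both ends.  The values of x and y
   away from [0, t] are otherwise irrelevant. *)
Definition solves_on (p : R -> R) (eps t : R) (x y : R -> R) : Prop :=
  forall s : R, 0 <= s <= t ->
    -1 / 2 < x s /\
    is_derive x s (y s) /\
    is_derive y s (-1 + 1 / sqrt (2 * x s + 1) + eps * p s).

(* Some solution starting in B is defined on [0, t] and lies outside K at time
   t.  Since solutions are unique, (x t, y t) is the value at t of the flow. *)
Definition flow_not_within (p : R -> R) (eps t : R) (B K : R * R -> Prop) : Prop :=
  exists x y : R -> R,
    B (x 0, y 0) /\ solves_on p eps t x y /\ ~ K (x t, y t).

Definition resonant_on_compact_subsets (p : R -> R) : Prop :=
  forall K : R * R -> Prop,
    compact_set K ->
    nonempty_interior K ->
    (forall z : R * R, K z -> period_annulus z) ->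
    forall d : R, 0 < d ->
    exists eps_star : R, 0 < eps_star /\
      forall eps : R, 0 < Rabs eps < eps_star ->
      forall c : R * R,
        (forall z : R * R, open_disc c (d / 2) z -> K z) ->
        exists t : R, 0 < t /\ flow_not_within p eps t (open_disc c (d / 2)) K.

(* Main.v *)
Require Import Defs.
From Stdlib Require Import Reals Factorial Lra Psatz Lia Classical List.
From Coquelicot Require Import Coquelicot.
Open Scope R_scope.

(** Put [u = sqrt (2 x + 1)].  Then [V (x) = (u - 1)^2 / 2], and in the time [s]
    with [dt = u ds] the unperturbed system is the harmonic oscillator
    [du/ds = y], [dy/ds = - (u - 1)].  On an orbit of radius [r < 1] one has
    [u = 1 + r cos s], [y = - r sin s], and [t] and [s] are related by
    Kepler's equation [t = s + r sin s] (up to constants): this is where the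
    Bessel functions come from.

    Write the forcing as [p (t) = a0 + A cos (t - ph)], let
    [sigma = y + t - ph] be the eccentric anomaly seen from a frame that
    rotates with the forcing, and let [X + i Y = (u - 1 - i y) exp (- i sigma)].
    The pair [(X, Y)] is constant on unperturbed orbits, the position is
    recovered by [u = 1 + X cos sigma - Y sin sigma] and
    [t - ph = sigma + X sin sigma + Y cos sigma], and along a perturbed solution
    [- Y' = eps p (t) (cos sigma + X)] exactly.  Hence, over one turn of [sigma],
    [- Y] grows by [eps] times the integral of
    [(a0 + A cos (s + X sin s + Y cos s)) (cos s + X) (1 + X cos s - Y sin s)],
    up to [O (eps^2)] because [X] and [Y] move by [O (eps)] only.

    Integrating by parts, this integral equals
    [3 PI a0 X + A * integral of sin s sin (s + X sin s + Y cos s)].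
    Symmetries of the last integrand and one more integration by parts show that
    on the unit disc its integral is smallest at [(1, 0)] and [(-1, 0)], where it
    is the integral of [sin^2 s cos (sin s)]; expanding the cosine turns this number
    into [2 PI (J_1(1) - J_2(1)) = 2 PI J_1'(1)] ([mean_drift_ge],
    [bessel_slope_eq]).  As [|X| <= 1], the hypothesis on [a0, a1, b1] says
    exactly that the mean of the drift is bounded below by a positive constant
    on the whole annulus.  So [Y] is a strict Lyapunov function, up to the sign
    of [eps]: every turn spent in [K] moves it by at least a fixed multiple of
    [|eps|] ([drift_one_turn]), whereas it is bounded by [1]
    ([confinement_time_bound]).  Every solution starting in [K] therefore leaves
    [K], in particular the one that starts at the centre of the ball.

    It remains to have solutions that live long enough.  A compact subset of the
    annulus stays away from the singularity [u = 0]; so the vector field is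
    replaced there by a globally Lipschitz one, whose solutions are global
    ([cauchy_lipschitz]).  Those that start in [K] solve the original system as
    long as they stay in [K], and slightly beyond ([first_exit]). *)

#[local] Arguments pow : simpl never.

(** * Integrals of periodic functions and the averaged drift *)

Lemma continuous_ex_RInt (f : R -> R) (a b : R) :
  (forall s, continuous f s) -> ex_RInt f a b.
Proof.
intros Hc; apply (ex_RInt_continuous (V := R_CompleteNormedModule)).
intros; apply Hc.
Qed.

Ltac smooth :=
  apply (@ex_derive_continuous R_AbsRing R_NormedModule); auto_derive; auto.

Lemma RInt_translate (f : R -> R) (a b c : R) :
  (forall s, continuous f s) ->
  RInt (fun s => f (s + c)) a b = RInt f (a + c) (b + c).
Proof.
intros Hc.
replace (a + c) with (1 * a + c) by ring.
replace (b + c) with (1 * b + c) by ring.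
rewrite <- (RInt_comp_lin f 1 c a b) by (apply continuous_ex_RInt; assumption).
apply RInt_ext; intros s _.
unfold scal; simpl; unfold mult; simpl; rewrite !Rmult_1_l; reflexivity.
Qed.

Lemma RInt_period (f : R -> R) (a b : R) :
  (forall s, continuous f s) -> (forall s, f (s + 2 * PI) = f s) ->
  RInt f a (a + 2 * PI) = RInt f b (b + 2 * PI).
Proof.
intros Hc Hp.
assert (Hi : forall u v, ex_RInt f u v)
  by (intros; apply continuous_ex_RInt; assumption).
rewrite <- (RInt_Chasles f a b (a + 2 * PI)) by apply Hi.
rewrite <- (RInt_Chasles f b (b + 2 * PI) (a + 2 * PI)) by apply Hi.
rewrite <- (RInt_translate f b a (2 * PI)) by assumption.
rewrite (RInt_ext (fun s => f (s + 2 * PI)) f) by (intros; apply Hp).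
rewrite <- (opp_RInt_swap f a b) by apply Hi.
unfold plus, opp; simpl; ring.
Qed.

Lemma RInt_period_translate (f : R -> R) (c : R) :
  (forall s, continuous f s) -> (forall s, f (s + 2 * PI) = f s) ->
  RInt (fun s => f (s + c)) 0 (2 * PI) = RInt f 0 (2 * PI).
Proof.
intros Hc Hp.
rewrite RInt_translate by assumption.
replace (2 * PI + c) with ((0 + c) + 2 * PI) by ring.
rewrite (RInt_period f (0 + c) 0) by assumption.
f_equal; ring.
Qed.

(** Shifting by half a period changes the sign of the integral, shifting by a
    period leaves it alone. *)
Lemma RInt_period_antiperiodic (f : R -> R) :
  (forall s, continuous f s) -> (forall s, f (s + PI) = - f s) ->
  RInt f 0 (2 * PI) = 0.
Proof.
intros Hc Ha.
assert (H := RInt_period_translate f PI Hc).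
rewrite (RInt_ext _ (fun s => opp (f s))) in H by (intros; apply Ha).
rewrite (RInt_opp f) in H by (apply continuous_ex_RInt; assumption).
assert (Hp : forall s, f (s + 2 * PI) = f s).
{ intros s; replace (s + 2 * PI) with (s + PI + PI) by ring.
  rewrite !Ha; ring. }
specialize (H Hp); unfold opp in H; simpl in H; lra.
Qed.

Lemma RInt_period_odd (f : R -> R) :
  (forall s, continuous f s) -> (forall s, f (s + 2 * PI) = f s) ->
  (forall s, f (- s) = - f s) -> RInt f 0 (2 * PI) = 0.
Proof.
intros Hc Hp Ho.
assert (Hi : forall u v, ex_RInt f u v)
  by (intros; apply continuous_ex_RInt; assumption).
assert (H := RInt_comp_lin f (-1) 0 0 (2 * PI) (Hi _ _)).
rewrite (RInt_ext _ f) in H.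
2:{ intros s _; unfold scal; simpl; unfold mult; simpl.
    replace (-1 * s + 0) with (- s) by ring; rewrite Ho; ring. }
replace (-1 * 0 + 0) with 0 in H by ring.
replace (-1 * (2 * PI) + 0) with (- (2 * PI)) in H by ring.
rewrite <- (opp_RInt_swap f (- (2 * PI)) 0) in H by apply Hi.
assert (Hs := RInt_period f 0 (- (2 * PI)) Hc Hp).
rewrite Rplus_0_l, Rplus_opp_l in Hs.
unfold opp in H; simpl in H; lra.
Qed.

Lemma RInt_period_derivative (F f : R -> R) :
  (forall s, is_derive F s (f s)) -> (forall s, continuous f s) ->
  F (2 * PI) = F 0 -> RInt f 0 (2 * PI) = 0.
Proof.
intros Hd Hc Hp.
rewrite (is_RInt_unique f 0 (2 * PI) (minus (F (2 * PI)) (F 0))).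
- rewrite Hp; unfold minus, plus, opp; simpl; ring.
- apply (is_RInt_derive (V := R_CompleteNormedModule) F f); intros; [apply Hd | apply Hc].
Qed.

Lemma polar_coordinates (X Y : R) :
  exists r th, 0 <= r /\ r ^ 2 = X ^ 2 + Y ^ 2 /\ X = r * cos th /\ Y = r * sin th.
Proof.
set (r := sqrt (X ^ 2 + Y ^ 2)).
assert (Hr0 : 0 <= r) by apply sqrt_pos.
assert (Hr2 : r ^ 2 = X ^ 2 + Y ^ 2) by (apply pow2_sqrt; nra).
destruct (Req_dec r 0) as [H0 | H0].
- exists 0, 0; rewrite H0 in Hr2. repeat split; nra.
- assert (Hr : 0 < r) by lra.
  assert (Hb : -1 <= X / r <= 1).
  { split; [apply Rle_div_r | apply Rle_div_l]; nra. }
  assert (Hs : sin (acos (X / r)) = Rabs Y / r).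
  { rewrite sin_acos by assumption.
    replace (1 - (X / r)²) with ((Rabs Y / r) ^ 2).
    - apply sqrt_pow2. apply Rdiv_le_0_compat; [apply Rabs_pos | assumption].
    - unfold Rdiv; rewrite Rpow_mult_distr, pow2_abs. unfold Rsqr.
      replace (Y ^ 2) with (r ^ 2 - X ^ 2) by lra. field; assumption. }
  destruct (Rle_dec 0 Y) as [HY | HY].
  + exists r, (acos (X / r)). rewrite cos_acos, Hs, Rabs_pos_eq by assumption.
    repeat split; try assumption; field; assumption.
  + exists r, (- acos (X / r)). rewrite cos_neg, sin_neg, cos_acos, Hs by assumption.
    rewrite Rabs_left by lra.
    repeat split; try assumption; field; assumption.
Qed.

(** The number [J_1'(1)], in its integral form. *)
Definition bessel_slope : R := RInt (fun s => sin s ^ 2 * cos (sin s)) 0 (2 * PI) / (2 * PI).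

Lemma cos_le_of_abs_le (a b : R) :
  Rabs a <= Rabs b <= 1 -> cos b <= cos a.
Proof.
intros Hab.
assert (HPI := PI2_1).
assert (Hc : forall w, cos (Rabs w) = cos w).
{ intros w; unfold Rabs; destruct Rcase_abs; [apply cos_neg | reflexivity]. }
rewrite <- (Hc a), <- (Hc b).
assert (0 <= Rabs a) by apply Rabs_pos.
apply cos_decr_1; lra.
Qed.

(** The difference is the integral of [cos (2 v) cos (r sin v)], that is
    [2 PI J_2(r)]; integration by parts gives it a nonnegative integrand. *)
Lemma cos_weight_ge_sin_weight (r : R) : 0 <= r <= 1 ->
  RInt (fun v => sin v ^ 2 * cos (r * sin v)) 0 (2 * PI) <=
  RInt (fun v => cos v ^ 2 * cos (r * sin v)) 0 (2 * PI).
Proof.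
intros Hr.
assert (HPI := PI_RGT_0).
assert (H : RInt (fun v => (cos v ^ 2 * cos (r * sin v) - sin v ^ 2 * cos (r * sin v))
   - r * sin v * cos v ^ 2 * sin (r * sin v)) 0 (2 * PI) = 0).
{ apply (RInt_period_derivative (fun v => sin v * cos v * cos (r * sin v))).
  - intros s; auto_derive; auto. ring.
  - intros; smooth.
  - rewrite sin_2PI, sin_0; ring. }
rewrite (RInt_minus (V := R_CompleteNormedModule)) in H
  by (apply continuous_ex_RInt; intros; smooth).
rewrite (RInt_minus (V := R_CompleteNormedModule)) in H
  by (apply continuous_ex_RInt; intros; smooth).
assert (H1 : 0 <= RInt (fun v => r * sin v * cos v ^ 2 * sin (r * sin v)) 0 (2 * PI)).
{ apply RInt_ge_0; [lra | apply continuous_ex_RInt; intros; smooth |].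
  intros v _.
  assert (Hv := SIN_bound v). assert (HP2 := PI2_1).
  assert (0 <= (r * sin v) * sin (r * sin v)).
  { destruct (Rle_dec 0 (sin v)).
    - apply Rmult_le_pos; [nra |]. apply sin_ge_0; nra.
    - replace ((r * sin v) * sin (r * sin v)) with ((- (r * sin v)) * sin (- (r * sin v)))
        by (rewrite sin_neg; ring).
      apply Rmult_le_pos; [nra |]. apply sin_ge_0; nra. }
  replace (r * sin v * cos v ^ 2 * sin (r * sin v))
    with (r * sin v * sin (r * sin v) * cos v ^ 2) by ring.
  apply Rmult_le_pos; [assumption | apply pow2_ge_0]. }
unfold minus, plus, opp in H; simpl in H; lra.
Qed.

Lemma sin_weight_ge_slope (r : R) : 0 <= r <= 1 ->
  2 * PI * bessel_slope <= RInt (fun v => sin v ^ 2 * cos (r * sin v)) 0 (2 * PI).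
Proof.
intros Hr; assert (HPI := PI_RGT_0).
unfold bessel_slope.
set (J := RInt (fun s => sin s ^ 2 * cos (sin s)) 0 (2 * PI) : R).
replace (2 * PI * (J / (2 * PI))) with J by (field; lra).
apply RInt_le; [lra | apply continuous_ex_RInt; intros; smooth
  | apply continuous_ex_RInt; intros; smooth |].
intros v _; apply Rmult_le_compat_l; [apply pow2_ge_0 |].
assert (Hv := SIN_bound v).
assert (Hs : Rabs (sin v) <= 1) by (apply Rabs_le; lra).
assert (H0 := Rabs_pos (sin v)).
apply cos_le_of_abs_le; rewrite Rabs_mult, (Rabs_pos_eq r) by lra.
split; nra.
Qed.

(** Expanding [sin (v - th)] gives the convex combination of the two weights with
    coefficients [cos th ^ 2] and [sin th ^ 2]; the mixed term is odd. *)
Lemma rotated_weight_ge_slope (r th : R) : 0 <= r <= 1 ->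
  2 * PI * bessel_slope <= RInt (fun v => sin (v - th) ^ 2 * cos (r * sin v)) 0 (2 * PI).
Proof.
intros Hr.
assert (H0 : RInt (fun v => 2 * sin v * cos v * cos (r * sin v)) 0 (2 * PI) = 0).
{ apply RInt_period_odd.
  - intros; smooth.
  - intros s; rewrite sin_plus, cos_plus, sin_2PI, cos_2PI.
    rewrite !Rmult_1_r, !Rmult_0_r, Rplus_0_r, Rminus_0_r; reflexivity.
  - intros s; rewrite sin_neg, cos_neg.
    replace (r * - sin s) with (- (r * sin s)) by ring; rewrite cos_neg; ring. }
assert (He : RInt (fun v => sin (v - th) ^ 2 * cos (r * sin v)) 0 (2 * PI) =
  cos th ^ 2 * RInt (fun v => sin v ^ 2 * cos (r * sin v)) 0 (2 * PI)
  + sin th ^ 2 * RInt (fun v => cos v ^ 2 * cos (r * sin v)) 0 (2 * PI)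
  - (sin th * cos th) * RInt (fun v => 2 * sin v * cos v * cos (r * sin v)) 0 (2 * PI)).
{ apply is_RInt_unique.
  apply (is_RInt_ext (fun v => minus (plus
     (scal (cos th ^ 2) (sin v ^ 2 * cos (r * sin v)))
     (scal (sin th ^ 2) (cos v ^ 2 * cos (r * sin v))))
     (scal (sin th * cos th) (2 * sin v * cos v * cos (r * sin v))))).
  { intros v _; rewrite sin_minus; unfold minus, plus, opp, scal; simpl.
    unfold mult; simpl; ring. }
  apply (is_RInt_minus (V := R_NormedModule));
  [apply (is_RInt_plus (V := R_NormedModule)) |];
  apply (is_RInt_scal (V := R_NormedModule));
  apply (RInt_correct (V := R_CompleteNormedModule)), continuous_ex_RInt; intros; smooth. }
assert (H1 := cos_weight_ge_sin_weight r Hr).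
assert (H2 := sin_weight_ge_slope r Hr).
rewrite He, H0.
assert (Ht := sin2_cos2 th); unfold Rsqr in Ht.
set (A := RInt (fun v => sin v ^ 2 * cos (r * sin v)) 0 (2 * PI) : R) in *.
set (B := RInt (fun v => cos v ^ 2 * cos (r * sin v)) 0 (2 * PI) : R) in *.
replace (cos th ^ 2 * A) with (A - sin th ^ 2 * A)
  by (replace (cos th ^ 2) with (1 - sin th ^ 2) by nra; ring).
assert (0 <= sin th ^ 2 * (B - A))
  by (apply Rmult_le_pos; [apply pow2_ge_0 | lra]).
lra.
Qed.

(** With [X sin s + Y cos s = r sin (s + th)], the part of the integrand that
    contains [sin (r sin (s + th))] changes sign under [s -> s + PI]. *)
Lemma kepler_term_ge_slope (X Y : R) : X ^ 2 + Y ^ 2 <= 1 ->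
  2 * PI * bessel_slope <=
  RInt (fun s => sin s * sin (s + (X * sin s + Y * cos s))) 0 (2 * PI).
Proof.
intros HXY.
destruct (polar_coordinates X Y) as (r & th & Hr0 & Hr2 & HX & HY).
assert (Hr : 0 <= r <= 1) by nra.
rewrite (RInt_ext _ (fun s => plus (sin s ^ 2 * cos (r * sin (s + th)))
   (sin s * cos s * sin (r * sin (s + th))))).
2:{ intros s _. rewrite (sin_plus s (X * _ + _)).
    replace (X * sin s + Y * cos s) with (r * sin (s + th))
      by (rewrite sin_plus, HX, HY; ring).
    unfold plus; simpl; ring. }
rewrite (RInt_plus (V := R_CompleteNormedModule)) by (apply continuous_ex_RInt; intros; smooth).
rewrite (RInt_period_antiperiodic (fun s => sin s * cos s * sin (r * sin (s + th)))).
- unfold plus; simpl; rewrite Rplus_0_r.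
  apply Rle_trans with (1 := rotated_weight_ge_slope r th Hr).
  right.
  rewrite <- (RInt_period_translate (fun v => sin (v - th) ^ 2 * cos (r * sin v)) th).
  + apply RInt_ext; intros s _. do 3 f_equal. ring.
  + intros; smooth.
  + intros s. replace (s + 2 * PI - th) with (s - th + 2 * PI) by ring.
    rewrite !sin_plus, cos_2PI, sin_2PI, !Rmult_1_r, !Rmult_0_r, !Rplus_0_r; reflexivity.
- intros; smooth.
- intros s. replace (s + PI + th) with (s + th + PI) by ring.
  rewrite !neg_sin, neg_cos.
  replace (r * - sin (s + th)) with (- (r * sin (s + th))) by ring.
  rewrite sin_neg; ring.
Qed.

(** To first order in [eps], [- Y] grows at [eps] times this rate per unit of
    eccentric anomaly [s], on the orbit of slow position [(X, Y)]: the forcing at Kepler time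
    [s + X sin s + Y cos s], times its coefficient [cos s + X], times [dt/ds]. *)
Definition drift (a0 A X Y s : R) : R :=
  (a0 + A * cos (s + (X * sin s + Y * cos s))) * (cos s + X)
  * (1 + X * cos s - Y * sin s).

(** The last factor of the drift is the derivative of the argument of the cosine,
    so an integration by parts removes both, leaving [sin s sin (...)].
    The rest is a trigonometric polynomial of mean [3/2 a0 X]. *)
Lemma mean_drift_ge (a0 A X Y b : R) : 0 <= A -> X ^ 2 + Y ^ 2 <= 1 ->
  2 * PI * (A * bessel_slope - 3 / 2 * Rabs a0) <= RInt (drift a0 A X Y) b (b + 2 * PI).
Proof.
intros HA HXY. assert (HPI := PI_RGT_0).
rewrite (RInt_period _ b 0).
2:{ intros; unfold drift; smooth. }
2:{ intros s; unfold drift.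
    rewrite (sin_plus s), (cos_plus s (2 * PI)), cos_2PI, sin_2PI,
      !Rmult_1_r, !Rmult_0_r, !Rplus_0_r, Rminus_0_r.
    replace (s + 2 * PI + (X * sin s + Y * cos s))
      with (s + (X * sin s + Y * cos s) + 2 * PI) by ring.
    rewrite (cos_plus _ (2 * PI)), cos_2PI, sin_2PI, Rmult_1_r, Rmult_0_r, Rminus_0_r.
    reflexivity. }
rewrite Rplus_0_l.
assert (H : RInt (fun s => minus (drift a0 A X Y s)
   (plus (scal A (sin s * sin (s + (X * sin s + Y * cos s)))) (3 / 2 * a0 * X))) 0 (2 * PI) = 0).
{ apply (RInt_period_derivative (fun s =>
     A * sin (s + (X * sin s + Y * cos s)) * (cos s + X)
     + a0 * (sin s + X * (sin s * cos s) / 2 + Y * cos s ^ 2 / 2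
             + X ^ 2 * sin s + X * Y * cos s))).
  - intros s; unfold drift, minus, plus, opp, scal; simpl; unfold mult; simpl.
    auto_derive; auto.
    assert (Hs := sin2_cos2 s); unfold Rsqr in Hs.
    replace (X * (1 * cos s * cos s + sin s * (1 * - sin s)))
     with (X * (2 * (cos s * cos s) - 1)) by (f_equal; lra).
    field.
  - intros s; unfold drift, minus, plus, opp, scal; simpl; unfold mult; simpl; smooth.
  - rewrite !sin_plus, !cos_2PI, !sin_2PI, !sin_0, !cos_0. ring. }
assert (Hex1 : ex_RInt (fun s => scal A (sin s * sin (s + (X * sin s + Y * cos s)))) 0 (2 * PI)).
{ apply continuous_ex_RInt; intros; unfold scal; simpl; unfold mult; simpl; smooth. }
rewrite (RInt_minus (V := R_CompleteNormedModule)) in H.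
3:{ apply @ex_RInt_plus; [assumption | apply ex_RInt_const]. }
2:{ apply continuous_ex_RInt; intros; unfold drift; smooth. }
rewrite (RInt_plus (V := R_CompleteNormedModule)) in H by (try assumption; apply ex_RInt_const).
rewrite (RInt_scal (V := R_CompleteNormedModule)) in H
  by (apply continuous_ex_RInt; intros; smooth).
rewrite RInt_const in H.
assert (HK := kepler_term_ge_slope X Y HXY).
unfold minus, plus, opp, scal in H; simpl in H; unfold mult in H; simpl in H.
rewrite Rminus_0_r in H.
set (I1 := RInt (drift a0 A X Y) 0 (2 * PI) : R) in *.
set (I2 := RInt (fun s => sin s * sin (s + (X * sin s + Y * cos s))) 0 (2 * PI) : R) in *.
assert (A * (2 * PI * bessel_slope) <= A * I2)
  by (apply Rmult_le_compat_l; assumption).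
assert (- Rabs a0 <= a0 * X).
{ assert (Rabs (a0 * X) <= Rabs a0).
  { rewrite Rabs_mult. assert (Rabs X <= 1) by (apply Rabs_le; nra).
    assert (0 <= Rabs a0) by apply Rabs_pos. nra. }
  assert (H4 := Rle_abs (- (a0 * X))). rewrite Rabs_Ropp in H4. lra. }
nra.
Qed.

(** * The least mean value and the Bessel functions *)

Definition wallis (k : nat) : R := RInt (fun s => sin s ^ (2 * k)) 0 (2 * PI).

Lemma continuous_sin_pow k s : continuous (fun s => sin s ^ k) s.
Proof. smooth. Qed.

Lemma wallis_step (k : nat) :
  INR (2 * k + 2) * wallis (S k) = INR (2 * k + 1) * wallis k.
Proof.
assert (H : RInt (fun s => minus (scal (INR (2 * k + 1)) (sin s ^ (2 * k)))
   (scal (INR (2 * k + 2)) (sin s ^ (2 * S k)))) 0 (2 * PI) = 0).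
{ apply (RInt_period_derivative (fun s => cos s * sin s ^ (2 * k + 1))).
  - intros s; auto_derive; auto.
    unfold minus, plus, opp, scal; simpl; unfold mult; simpl.
    assert (Hs := sin2_cos2 s); unfold Rsqr in Hs.
    replace (k + S (k + 0))%nat with (S (2 * k)) by lia.
    replace (k + (k + 0))%nat with (2 * k)%nat by lia.
    replace (2 * k + 1)%nat with (S (2 * k)) by lia.
    replace (2 * k + 2)%nat with (S (S (2 * k))) by lia.
    rewrite Nat.pred_succ, !S_INR, <- !tech_pow_Rmult.
    set (z := sin s ^ (2 * k)).
    replace (cos s * (1 * cos s * ((INR (2 * k) + 1) * z)))
      with ((INR (2 * k) + 1) * (z * (cos s * cos s))) by ring.
    replace (cos s * cos s) with (1 - sin s * sin s) by lra. ring.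
  - intros s; unfold minus, plus, opp, scal; simpl; unfold mult; simpl. smooth.
  - rewrite sin_2PI, cos_2PI, sin_0, cos_0; reflexivity. }
rewrite (RInt_minus (V := R_CompleteNormedModule)) in H
  by (apply @ex_RInt_scal, continuous_ex_RInt; apply continuous_sin_pow).
rewrite !(RInt_scal (V := R_CompleteNormedModule)) in H
  by (apply continuous_ex_RInt; apply continuous_sin_pow).
change (INR (2 * k + 1) * wallis k + - (INR (2 * k + 2) * wallis (S k)) = 0) in H.
lra.
Qed.

Lemma wallis_eq (k : nat) :
  wallis k = 2 * PI * (INR (fact (2 * k)) / (4 ^ k * INR (fact k) ^ 2)).
Proof.
induction k as [|k IH].
- unfold wallis; rewrite (RInt_ext _ (fun _ => 1)) by reflexivity.
  rewrite RInt_const; simpl; unfold scal; simpl; unfold mult, pow; simpl; field.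
- apply Rmult_eq_reg_l with (INR (2 * k + 2)).
  2:{ apply not_0_INR; lia. }
  rewrite wallis_step, IH.
  replace (2 * S k)%nat with (S (S (2 * k))) by lia.
  rewrite !fact_simpl, !mult_INR.
  replace (2 * k + 2)%nat with (S (S (2 * k))) by lia.
  replace (2 * k + 1)%nat with (S (2 * k)) by lia.
  assert (0 < INR (fact k)) by apply INR_fact_lt_0.
  assert (0 < 4 ^ k) by (apply pow_lt; lra).
  assert (0 <= INR k) by apply pos_INR.
  rewrite !S_INR.
  change (4 ^ S k) with (4 * 4 ^ k).
  replace (INR (2 * k)) with (2 * INR k) by (rewrite mult_INR; reflexivity).
  field. lra.
Qed.

(** [2 PI] times the terms of the series of [J_1'(1)]. *)
Definition slope_term (m : nat) : R :=
  (-1) ^ m * (wallis (S m) / INR (fact (2 * m))).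

Lemma RInt_cos_approx (n : nat) :
  is_RInt (fun s => sin s ^ 2 * cos_approx (sin s) n) 0 (2 * PI)
   (sum_f_R0 slope_term n).
Proof.
assert (Ht : forall m, is_RInt (fun s => sin s ^ 2 * cos_term (sin s) m) 0 (2 * PI) (slope_term m)).
{ intros m. unfold slope_term.
  replace ((-1) ^ m * (wallis (S m) / INR (fact (2 * m))))
    with (scal ((-1) ^ m / INR (fact (2 * m))) (wallis (S m)))
    by (unfold scal; simpl; unfold mult; simpl; field; apply INR_fact_neq_0).
  apply (is_RInt_ext (fun s => scal ((-1) ^ m / INR (fact (2 * m))) (sin s ^ (2 * S m)))).
  { intros s _; unfold cos_term.
    change ((-1) ^ m / INR (fact (2 * m)) * sin s ^ (2 * S m) =
      sin s ^ 2 * ((-1) ^ m * (sin s ^ (2 * m) / INR (fact (2 * m))))).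
    replace (2 * S m)%nat with (2 + 2 * m)%nat by lia; rewrite pow_add.
    field; apply INR_fact_neq_0. }
  apply (is_RInt_scal (V := R_NormedModule)).
  apply (RInt_correct (V := R_CompleteNormedModule)), continuous_ex_RInt.
  apply continuous_sin_pow. }
induction n as [|n IH].
- apply Ht.
- simpl. apply (is_RInt_ext (fun s => plus (sin s ^ 2 * cos_approx (sin s) n)
     (sin s ^ 2 * cos_term (sin s) (S n)))).
  { intros; unfold cos_approx, plus; simpl; ring. }
  apply (is_RInt_plus (V := R_NormedModule)); [apply IH | apply Ht].
Qed.

Lemma inv_fact_double_le (m : nat) : / INR (fact (2 * m)) <= (/ 2) ^ m.
Proof.
rewrite pow_inv; apply Rinv_le_contravar; [apply pow_lt; lra |].
induction m as [|m IH].
- unfold pow; simpl; lra.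
- replace (2 * S m)%nat with (S (S (2 * m))) by lia.
  rewrite !fact_simpl, !mult_INR, <- tech_pow_Rmult.
  assert (0 < 2 ^ m) by (apply pow_lt; lra).
  assert (0 <= INR (2 * m)) by apply pos_INR.
  rewrite !S_INR.
  apply Rmult_le_compat; [lra | lra | lra |].
  nra.
Qed.

Lemma wallis_bound (k : nat) : 0 <= wallis k <= 2 * PI.
Proof.
assert (HPI := PI_RGT_0).
assert (Hs : forall s, 0 <= sin s ^ (2 * k) <= 1).
{ intros s; rewrite pow_mult. assert (Hb := SIN_bound s).
  split; [apply pow_le, pow2_ge_0 |].
  rewrite <- (pow1 k); apply pow_incr; nra. }
split.
- apply RInt_ge_0; [lra | apply continuous_ex_RInt, continuous_sin_pow |].
  intros; apply Hs.
- replace (2 * PI) with (RInt (fun _ => 1) 0 (2 * PI)).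
  + apply RInt_le; [lra | apply continuous_ex_RInt, continuous_sin_pow
      | apply ex_RInt_const |].
    intros; apply Hs.
  + rewrite RInt_const; unfold scal; simpl; unfold mult; simpl; ring.
Qed.

Lemma slope_term_bound (m : nat) : Rabs (slope_term m) <= 2 * PI * (/ 2) ^ m.
Proof.
unfold slope_term, Rdiv; rewrite !Rabs_mult, pow_1_abs, Rmult_1_l.
assert (Hw := wallis_bound (S m)).
assert (0 < / INR (fact (2 * m))) by apply Rinv_0_lt_compat, INR_fact_lt_0.
rewrite !Rabs_pos_eq by lra.
apply Rmult_le_compat; [lra | lra | lra | apply inv_fact_double_le].
Qed.

(** The Taylor polynomials of the cosine bound it alternately from below and from
    above; their integrals therefore enclose [2 PI bessel_slope]. *)
Lemma slope_series : is_series slope_term (2 * PI * bessel_slope).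
Proof.
assert (HPI := PI_RGT_0).
set (f := fun s => sin s ^ 2 * cos (sin s)).
assert (Hb : 2 * PI * bessel_slope = RInt f 0 (2 * PI)).
{ unfold bessel_slope, f.
  set (J := RInt (fun s => sin s ^ 2 * cos (sin s)) 0 (2 * PI) : R). field; lra. }
assert (If : is_RInt f 0 (2 * PI) (2 * PI * bessel_slope)).
{ rewrite Hb. apply (RInt_correct (V := R_CompleteNormedModule)), continuous_ex_RInt.
  intros; unfold f; smooth. }
assert (Hsand : forall n, sum_f_R0 slope_term (2 * n + 1) <= 2 * PI * bessel_slope
                  <= sum_f_R0 slope_term (2 * (n + 1))).
{ intros n.
  assert (Hp : forall s, sin s ^ 2 * cos_approx (sin s) (2 * n + 1) <= f s
                <= sin s ^ 2 * cos_approx (sin s) (2 * (n + 1))).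
  { intros s. assert (Hs := SIN_bound s).
    destruct (pre_cos_bound (sin s) n) as [H1 H2]; [lra | lra |].
    split; apply Rmult_le_compat_l; try assumption; apply pow2_ge_0. }
  split.
  - apply (is_RInt_le _ f 0 (2 * PI) _ _ ltac:(lra) (RInt_cos_approx _) If).
    intros; apply Hp.
  - apply (is_RInt_le f _ 0 (2 * PI) _ _ ltac:(lra) If (RInt_cos_approx _)).
    intros; apply Hp. }
assert (Herr : forall n, Rabs (sum_f_R0 slope_term (S n) - 2 * PI * bessel_slope)
                  <= 2 * PI * (/ 2) ^ n).
{ intros n.
  assert (Hpow : forall k, (/ 2) ^ S k <= (/ 2) ^ k).
  { intros k; rewrite <- tech_pow_Rmult. assert (0 < (/ 2) ^ k) by (apply pow_lt; lra). lra. }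
  assert (Hn : forall k l, 0 <= k <= Rabs l -> Rabs k <= Rabs l).
  { intros k l Hk; rewrite (Rabs_pos_eq k); lra. }
  destruct (Nat.Even_or_Odd n) as [[k ->] | [k ->]].
  - destruct (Hsand k) as [H1 H2].
    replace (2 * k + 1)%nat with (S (2 * k)) in H1 by lia.
    replace (2 * (k + 1))%nat with (S (S (2 * k))) in H2 by lia.
    rewrite tech5 in H2.
    apply Rle_trans with (Rabs (slope_term (S (S (2 * k))))).
    + rewrite Rabs_minus_sym. apply Hn. assert (H3 := Rle_abs (slope_term (S (S (2 * k))))). lra.
    + apply Rle_trans with (1 := slope_term_bound _).
      apply Rmult_le_compat_l; [lra |].
      apply Rle_trans with (1 := Hpow _). apply Hpow.
  - destruct (Hsand k) as [H1 H2].
    replace (2 * k + 1)%nat with (S (2 * k)) in * by lia.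
    replace (2 * (k + 1))%nat with (S (S (2 * k))) in H2 by lia.
    rewrite (tech5 slope_term (S (2 * k))) in *.
    apply Rle_trans with (Rabs (slope_term (S (S (2 * k))))).
    + apply Hn. assert (H3 := Rle_abs (slope_term (S (S (2 * k))))).
      lra.
    + apply Rle_trans with (1 := slope_term_bound _).
      apply Rmult_le_compat_l; [lra |]. apply Hpow. }
assert (Hlim : is_lim_seq (fun n => sum_n slope_term n) (2 * PI * bessel_slope)); [| exact Hlim].
apply is_lim_seq_incr_1.
apply (is_lim_seq_ext (fun n => sum_f_R0 slope_term (S n))).
{ intros n; symmetry; apply sum_n_Reals. }
apply is_lim_seq_le_le with (fun n => 2 * PI * bessel_slope - 2 * PI * (/ 2) ^ n)
  (fun n => 2 * PI * bessel_slope + 2 * PI * (/ 2) ^ n).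
- intros n; assert (H := Herr n); apply Rabs_le_between in H. lra.
- replace (Finite (2 * PI * bessel_slope)) with (Finite (2 * PI * bessel_slope - 2 * PI * 0))
    by (f_equal; ring).
  apply is_lim_seq_minus'; [apply is_lim_seq_const |].
  apply (is_lim_seq_scal_l _ (2 * PI) 0), is_lim_seq_geom.
  rewrite Rabs_pos_eq; lra.
- replace (Finite (2 * PI * bessel_slope)) with (Finite (2 * PI * bessel_slope + 2 * PI * 0))
    by (f_equal; ring).
  apply is_lim_seq_plus'; [apply is_lim_seq_const |].
  apply (is_lim_seq_scal_l _ (2 * PI) 0), is_lim_seq_geom.
  rewrite Rabs_pos_eq; lra.
Qed.

Definition bessel_term (n m : nat) : R :=
  (-1) ^ m / (INR (fact m) * INR (fact (m + n))) * (1 / 2) ^ (2 * m + n).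

Lemma ex_series_bessel (n : nat) : ex_series (bessel_term n).
Proof.
apply (@ex_series_le R_AbsRing R_CompleteNormedModule) with (fun m => (/ 2) ^ m).
2:{ apply ex_series_geom; rewrite Rabs_pos_eq; lra. }
intros m; change (norm (bessel_term n m)) with (Rabs (bessel_term n m)).
unfold bessel_term, Rdiv; rewrite !Rabs_mult, pow_1_abs, !Rmult_1_l.
assert (Hf : forall k, 1 <= INR (fact k)).
{ intros k; apply (le_INR 1). apply lt_O_fact. }
assert (H1 := Hf m). assert (H2 := Hf (m + n)%nat).
rewrite <- (Rmult_1_l ((/ 2) ^ m)).
apply Rmult_le_compat; try apply Rabs_pos.
- rewrite Rabs_pos_eq; [| left; apply Rinv_0_lt_compat; nra].
  rewrite <- Rinv_1; apply Rinv_le_contravar; nra.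
- rewrite Rabs_pos_eq by (apply pow_le; lra).
  replace (2 * m + n)%nat with (m + (m + n))%nat by lia.
  rewrite pow_add.
  assert (0 <= (/ 2) ^ m) by (apply pow_le; lra).
  assert ((/ 2) ^ (m + n) <= 1)
    by (rewrite <- (pow1 (m + n)); apply pow_incr; lra).
  nra.
Qed.

(** The coefficient [2 m + 1] produced by [J_1'(1)] splits as [1 + 2 m]: the first
    part is the series of [J_1(1)], the second one, shifted by one index, that of
    [- J_2(1)]. *)
Lemma bessel_slope_eq : bessel_slope = BesselJ 1 1 - BesselJ 2 1.
Proof.
assert (HPI := PI_RGT_0).
destruct (ex_series_bessel 1 : exists l : R, is_series _ l) as [l1 H1].
destruct (ex_series_bessel 2 : exists l : R, is_series _ l) as [l2 H2].
change (bessel_slope = Series (bessel_term 1) - Series (bessel_term 2)).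
rewrite (is_series_unique _ _ H1), (is_series_unique _ _ H2).
set (shift := fun m => match m with O => 0 | S k => bessel_term 2 k end).
assert (Hterm : forall m, slope_term m = 2 * PI * (bessel_term 1 m - shift m)).
{ intros m; unfold slope_term; rewrite wallis_eq; unfold shift, bessel_term.
  destruct m as [|k]; [unfold pow; simpl; field |].
  replace (2 * S (S k))%nat with (S (S (S (S (2 * k))))) by lia.
  replace (2 * S k)%nat with (S (S (2 * k))) by lia.
  replace (S k + 1)%nat with (S (S k)) by lia.
  replace (k + 2)%nat with (S (S k)) by lia.
  replace (S (S (2 * k)) + 1)%nat with (S (S (S (2 * k)))) by lia.
  replace (2 * k + 2)%nat with (S (S (2 * k))) by lia.
  rewrite !fact_simpl, !mult_INR, !S_INR.
  replace (INR (2 * k)) with (2 * INR k) by (rewrite mult_INR; reflexivity).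
  assert (0 < INR (fact k)) by apply INR_fact_lt_0.
  assert (0 < INR (fact (2 * k))) by apply INR_fact_lt_0.
  assert (0 <= INR k) by apply pos_INR.
  unfold Rdiv; rewrite Rmult_1_l, <- !tech_pow_Rmult, (pow_mult (/ 2) 2 k).
  replace ((/ 2) ^ 2) with (/ 4) by (unfold pow; field).
  rewrite (pow_inv 4). 
  assert (0 < 4 ^ k) by (apply pow_lt; lra).
  field. repeat split; lra. }
assert (Hs : is_series shift l2).
{ apply (is_series_decr_1 (V := R_NormedModule)).
  apply (eq_ind l2 (fun z => is_series (bessel_term 2) z)); [exact H2 |].
  change (@eq R l2 (l2 + - 0)); ring. }
assert (Hd : is_series slope_term (2 * PI * (l1 - l2))).
{ apply (is_series_ext (fun m => scal (2 * PI) (minus (bessel_term 1 m) (shift m)))).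
  - intros m; rewrite Hterm; reflexivity.
  - apply (is_series_scal (V := R_NormedModule) (2 * PI)), (is_series_minus (V := R_NormedModule));
    assumption. }
assert (He := is_series_unique _ _ slope_series).
rewrite (is_series_unique _ _ Hd) in He.
apply Rmult_eq_reg_l with (2 * PI); lra.
Qed.

Lemma bessel_slope_pos : 0 < bessel_slope.
Proof.
assert (HPI := PI_RGT_0).
assert (H : 0 < 2 * PI * bessel_slope); [| nra].
apply Rlt_le_trans with (cos 1 * PI).
- apply Rmult_lt_0_compat; [apply cos_gt_0; assert (H := PI2_1); lra | lra].
- unfold bessel_slope. set (J := RInt (fun s => sin s ^ 2 * cos (sin s)) 0 (2 * PI) : R).
  replace (2 * PI * (J / (2 * PI))) with J by (field; lra).
  assert (Hw : RInt (fun s => scal (cos 1) (sin s ^ (2 * 1))) 0 (2 * PI) = cos 1 * PI).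
  { rewrite (RInt_scal (V := R_CompleteNormedModule))
      by (apply continuous_ex_RInt, continuous_sin_pow).
    change (cos 1 * wallis 1 = cos 1 * PI). rewrite wallis_eq.
    unfold pow; simpl; field. }
  rewrite <- Hw. apply RInt_le; [lra | | |].
  + apply @ex_RInt_scal, continuous_ex_RInt, continuous_sin_pow.
  + apply continuous_ex_RInt; intros; smooth.
  + intros s _. unfold scal; simpl; unfold mult; simpl.
    rewrite Rmult_comm. apply Rmult_le_compat_l; [apply pow2_ge_0 |].
    apply cos_le_of_abs_le; rewrite Rabs_R1.
    assert (Hs := SIN_bound s). split; [apply Rabs_le |]; lra.
Qed.

(** * Slow variables and their drift over one turn *)

Lemma increment_le (f df : R -> R) (a b M : R) : a <= b ->
  (forall s, a <= s <= b -> is_derive f s (df s)) ->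
  (forall s, a <= s <= b -> Rabs (df s) <= M) ->
  Rabs (f b - f a) <= M * (b - a).
Proof.
intros Hab Hd HM.
destruct (MVT_gen f a b df) as (c & Hc & He).
- intros s Hs; rewrite Rmin_left, Rmax_right in Hs by assumption; apply Hd; lra.
- intros s Hs; rewrite Rmin_left, Rmax_right in Hs by assumption.
  apply derivable_continuous_pt. exists (df s). apply is_derive_Reals, Hd; lra.
- rewrite Rmin_left, Rmax_right in Hc by assumption.
  rewrite He, Rabs_mult, (Rabs_pos_eq (b - a)) by lra.
  apply Rmult_le_compat_r; [lra | apply HM; lra].
Qed.

Lemma cos_lipschitz (a b : R) : Rabs (cos a - cos b) <= Rabs (a - b).
Proof.
assert (H : forall c d, c <= d -> Rabs (cos d - cos c) <= d - c).
{ intros c d Hcd. rewrite <- (Rmult_1_l (d - c)).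
  apply (increment_le cos (fun s => - sin s)); [assumption | |].
  - intros s _; auto_derive; auto; ring.
  - intros s _; rewrite Rabs_Ropp; apply Rabs_le, SIN_bound. }
destruct (Rle_dec a b) as [Hab | Hab].
- rewrite Rabs_minus_sym, (Rabs_minus_sym a), (Rabs_pos_eq (b - a)) by lra; auto.
- rewrite (Rabs_pos_eq (a - b)) by lra; apply H; lra.
Qed.

Definition forcing (a0 A ph t : R) : R := a0 + A * cos (t - ph).

(** Real and imaginary part of [(u - 1 - i y) exp (- i (y + t - ph))], which is
    constant along unperturbed orbits; [y + t - ph] is the eccentric anomaly. *)
Definition slow_x (ph t x y : R) : R :=
  (sqrt (2 * x + 1) - 1) * cos (y + t - ph) - y * sin (y + t - ph).

Definition slow_y (ph t x y : R) : R :=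
  - (sqrt (2 * x + 1) - 1) * sin (y + t - ph) - y * cos (y + t - ph).

Lemma slow_norm (ph t x y : R) :
  slow_x ph t x y ^ 2 + slow_y ph t x y ^ 2 = (sqrt (2 * x + 1) - 1) ^ 2 + y ^ 2.
Proof.
unfold slow_x, slow_y.
set (s := y + t - ph); set (v := sqrt (2 * x + 1) - 1).
assert (Hs := sin2_cos2 s); unfold Rsqr in Hs.
transitivity ((v ^ 2 + y ^ 2) * (sin s * sin s + cos s * cos s)); [ring |].
rewrite Hs; ring.
Qed.

Lemma slow_radius (ph t x y : R) :
  sqrt (2 * x + 1) = 1 + slow_x ph t x y * cos (y + t - ph)
                       - slow_y ph t x y * sin (y + t - ph).
Proof.
unfold slow_x, slow_y.
set (s := y + t - ph); set (u := sqrt (2 * x + 1)).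
assert (Hs := sin2_cos2 s); unfold Rsqr in Hs.
transitivity (1 + (u - 1) * (sin s * sin s + cos s * cos s)); [rewrite Hs | ]; ring.
Qed.

(** Kepler's equation in the rotating frame. *)
Lemma slow_kepler (ph t x y : R) :
  t - ph = (y + t - ph) + (slow_x ph t x y * sin (y + t - ph)
                         + slow_y ph t x y * cos (y + t - ph)).
Proof.
unfold slow_x, slow_y.
set (s := y + t - ph); set (u := sqrt (2 * x + 1)).
assert (Hs := sin2_cos2 s); unfold Rsqr in Hs.
transitivity (s - y * (sin s * sin s + cos s * cos s)); [rewrite Hs; unfold s | ]; ring.
Qed.

(** Pointwise in time, as the derivatives of the slow variables depend on the
    forcing only through its value [q] at that instant. *)
Definition motion_at (eps q : R) (x y : R -> R) (s : R) : Prop :=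
  -1 / 2 < x s /\ is_derive x s (y s) /\
  is_derive y s (-1 + 1 / sqrt (2 * x s + 1) + eps * q).

Lemma slow_x_derive (ph eps q : R) (x y : R -> R) (s : R) :
  motion_at eps q x y s ->
  is_derive (fun t => slow_x ph t (x t) (y t)) s
    (- eps * q * (sin (y s + s - ph) - slow_y ph s (x s) (y s))).
Proof.
intros (Hx0 & Hx & Hy).
assert (Hu : 0 < sqrt (2 * x s + 1)) by (apply sqrt_lt_R0; lra).
unfold slow_x, slow_y; auto_derive.
- repeat split; try (eexists; eassumption). lra.
- rewrite (is_derive_unique (fun t : R => x t) _ _ Hx),
    (is_derive_unique (fun t : R => y t) _ _ Hy).
  unfold Rminus. field. lra.
Qed.

Lemma slow_y_derive (ph eps q : R) (x y : R -> R) (s : R) :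
  motion_at eps q x y s ->
  is_derive (fun t => slow_y ph t (x t) (y t)) s
    (- eps * q * (cos (y s + s - ph) + slow_x ph s (x s) (y s))).
Proof.
intros (Hx0 & Hx & Hy).
assert (Hu : 0 < sqrt (2 * x s + 1)) by (apply sqrt_lt_R0; lra).
unfold slow_x, slow_y; auto_derive.
- repeat split; try (eexists; eassumption). lra.
- rewrite (is_derive_unique (fun t : R => x t) _ _ Hx),
    (is_derive_unique (fun t : R => y t) _ _ Hy).
  unfold Rminus. field. lra.
Qed.

Lemma anomaly_derive (ph eps q : R) (x y : R -> R) (s : R) :
  motion_at eps q x y s ->
  is_derive (fun t => y t + t - ph) s (/ sqrt (2 * x s + 1) + eps * q).
Proof.
intros (Hx0 & Hx & Hy).
assert (Hu : 0 < sqrt (2 * x s + 1)) by (apply sqrt_lt_R0; lra).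
auto_derive.
- repeat split; try (eexists; eassumption).
- rewrite (is_derive_unique (fun t : R => y t) _ _ Hy). field. lra.
Qed.

Lemma forcing_bound (a0 A z : R) : 0 <= A -> Rabs (a0 + A * cos z) <= Rabs a0 + A.
Proof.
intros HA. apply Rle_trans with (1 := Rabs_triang _ _).
rewrite Rabs_mult, (Rabs_pos_eq A) by assumption.
assert (Rabs (cos z) <= 1) by apply Rabs_le, COS_bound. nra.
Qed.

Lemma product_variation (a b c a' b' c' A B C da db dc : R) :
  Rabs b <= B -> Rabs c <= C -> Rabs a' <= A -> Rabs b' <= B ->
  Rabs (a - a') <= da -> Rabs (b - b') <= db -> Rabs (c - c') <= dc ->
  Rabs (a * b * c - a' * b' * c') <= da * B * C + A * db * C + A * B * dc.
Proof.
intros Hb Hc Ha' Hb' Hda Hdb Hdc.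
replace (a * b * c - a' * b' * c')
  with ((a - a') * b * c + a' * (b - b') * c + a' * b' * (c - c')) by ring.
assert (H3 : forall u v w U V W, Rabs u <= U -> Rabs v <= V -> Rabs w <= W ->
   Rabs (u * v * w) <= U * V * W).
{ intros u v w U V W Hu Hv Hw; rewrite !Rabs_mult.
  apply Rmult_le_compat; try assumption; try apply Rabs_pos.
  - apply Rmult_le_pos; apply Rabs_pos.
  - apply Rmult_le_compat; try assumption; apply Rabs_pos. }
apply Rle_trans with (1 := Rabs_triang _ _), Rplus_le_compat; [| auto].
apply Rle_trans with (1 := Rabs_triang _ _), Rplus_le_compat; auto.
Qed.

Lemma Rabs_mult_unit_le (X z d : R) : Rabs X <= d -> -1 <= z <= 1 -> Rabs (X * z) <= d.
Proof.
intros HX Hz; rewrite Rabs_mult.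
assert (Rabs z <= 1) by (apply Rabs_le; assumption).
assert (H0 := Rabs_pos X); assert (H1 := Rabs_pos z). nra.
Qed.

Lemma unit_disc_coordinates (X Y : R) : X ^ 2 + Y ^ 2 <= 1 -> Rabs X <= 1 /\ Rabs Y <= 1.
Proof. intros H; split; apply Rabs_le; nra. Qed.

Lemma anomaly_factor_bound (X s : R) : Rabs X <= 1 -> Rabs (cos s + X) <= 2.
Proof.
intros HX; apply Rle_trans with (1 := Rabs_triang _ _).
assert (Rabs (cos s) <= 1) by apply Rabs_le, COS_bound. lra.
Qed.

Lemma radius_bound (X Y s : R) : X ^ 2 + Y ^ 2 <= 1 ->
  Rabs (1 + X * cos s - Y * sin s) <= 3.
Proof.
intros H; destruct (unit_disc_coordinates X Y H) as [HX HY].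
assert (H1 := Rabs_mult_unit_le X (cos s) 1 HX (COS_bound s)).
assert (H2 := Rabs_mult_unit_le Y (sin s) 1 HY (SIN_bound s)).
apply Rabs_le_between in H1; apply Rabs_le_between in H2; apply Rabs_le; lra.
Qed.

Lemma drift_bound (a0 A X Y s : R) : 0 <= A -> X ^ 2 + Y ^ 2 <= 1 ->
  Rabs (drift a0 A X Y s) <= 6 * (Rabs a0 + A).
Proof.
intros HA H; destruct (unit_disc_coordinates X Y H) as [HX HY].
unfold drift; rewrite !Rabs_mult.
replace (6 * (Rabs a0 + A)) with ((Rabs a0 + A) * 2 * 3) by ring.
apply Rmult_le_compat; [apply Rmult_le_pos; apply Rabs_pos | apply Rabs_pos | |].
- apply Rmult_le_compat; try apply Rabs_pos.
  + apply forcing_bound; assumption.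
  + apply anomaly_factor_bound; assumption.
- apply radius_bound; assumption.
Qed.

Lemma drift_variation (a0 A X Y X' Y' s d : R) :
  0 <= A -> X ^ 2 + Y ^ 2 <= 1 -> X' ^ 2 + Y' ^ 2 <= 1 ->
  Rabs (X - X') <= d -> Rabs (Y - Y') <= d ->
  Rabs (drift a0 A X Y s - drift a0 A X' Y' s) <= 19 * (Rabs a0 + A) * d.
Proof.
intros HA H H' HdX HdY; set (P := Rabs a0 + A).
destruct (unit_disc_coordinates X Y H) as [HX HY].
destruct (unit_disc_coordinates X' Y' H') as [HX' HY'].
assert (HP : A <= P) by (unfold P; assert (Hp := Rabs_pos a0); lra).
assert (Hd : 0 <= d) by (assert (Hp := Rabs_pos (X - X')); lra).
assert (Hpos : forall z w, -1 <= z <= 1 -> -1 <= w <= 1 ->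
   Rabs ((X - X') * z + (Y - Y') * w) <= 2 * d).
{ intros z w Hz Hw.
  apply Rle_trans with (1 := Rabs_triang _ _).
  assert (H1 := Rabs_mult_unit_le _ z d HdX Hz).
  assert (H2 := Rabs_mult_unit_le _ w d HdY Hw). lra. }
assert (Hs := SIN_bound s); assert (Hc := COS_bound s).
apply Rle_trans with (A * (2 * d) * 2 * 3 + P * d * 3 + P * 2 * (2 * d)); [| nra].
apply product_variation.
- apply anomaly_factor_bound; assumption.
- apply radius_bound; assumption.
- apply forcing_bound; assumption.
- apply anomaly_factor_bound; assumption.
- match goal with |- Rabs (a0 + A * cos ?u - (a0 + A * cos ?v)) <= _ =>
    replace (a0 + A * cos u - (a0 + A * cos v)) with (A * (cos u - cos v)) by ring end.
  rewrite Rabs_mult, (Rabs_pos_eq A) by assumption.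
  apply Rmult_le_compat_l; [assumption |].
  apply Rle_trans with (1 := cos_lipschitz _ _).
  replace (_ - _) with ((X - X') * sin s + (Y - Y') * cos s) by ring.
  apply Hpos; assumption.
- replace (_ - _) with (X - X') by ring; assumption.
- replace (_ - _) with ((X - X') * cos s + (Y - Y') * (- sin s)) by ring.
  apply Hpos; lra.
Qed.

(** A turn takes time at most [10]; during it the slow variables move by at most
    [20 P |eps|] with [P = |a0| + A], and the drift is [19 P]-Lipschitz in them:
    hence [380 = 19 * 20].  The derivative of the anomaly is [1 / u + eps p]:
    its first term is at most [1 / m], the second one gives the summand [6]. *)
Definition turn_error (a0 A m : R) : R :=
  10 * (Rabs a0 + A) ^ 2 * (380 / m + 6).

(** Compare [- Y] with [eps] times the primitive of the drift frozen at the initial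
    slow position, evaluated at the current anomaly.  The derivative of the
    difference is [O (eps^2)], and over a full turn of the anomaly, rather than
    a full period of time, the primitive increases by exactly the period
    integral. *)
Lemma drift_one_turn (a0 A ph eps m t0 : R) (x y : R -> R) :
  0 <= A -> 0 < m ->
  (forall s, t0 <= s <= t0 + 10 ->
     motion_at eps (forcing a0 A ph s) x y s /\ m <= sqrt (2 * x s + 1) /\
     (sqrt (2 * x s + 1) - 1) ^ 2 + y s ^ 2 <= 1) ->
  let X0 := slow_x ph t0 (x t0) (y t0) in
  let Y0 := slow_y ph t0 (x t0) (y t0) in
  let s0 := y t0 + t0 - ph in
  exists t1, t0 <= t1 <= t0 + 10 /\
    Rabs (Y0 - slow_y ph t1 (x t1) (y t1)
          - eps * RInt (drift a0 A X0 Y0) s0 (s0 + 2 * PI))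
    <= turn_error a0 A m * eps ^ 2.
Proof.
intros HA Hm Hsol X0 Y0 s0.
assert (HPI := PI_4). assert (HPI0 := PI_RGT_0).
set (P := Rabs a0 + A).
assert (HP : 0 <= P) by (unfold P; assert (Hp := Rabs_pos a0); lra).
set (X := fun t => slow_x ph t (x t) (y t)).
set (Y := fun t => slow_y ph t (x t) (y t)).
set (S := fun t => y t + t - ph).
assert (Hn : forall s, t0 <= s <= t0 + 10 -> X s ^ 2 + Y s ^ 2 <= 1).
{ intros s Hs; unfold X, Y; rewrite slow_norm; apply Hsol, Hs. }
assert (Hf : forall s, Rabs (forcing a0 A ph s) <= P) by (intros; apply forcing_bound, HA).
assert (Hy : forall s, t0 <= s <= t0 + 10 -> -1 <= y s <= 1).
{ intros s Hs; destruct (Hsol s Hs) as (_ & _ & Hr).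
  assert (0 <= (sqrt (2 * x s + 1) - 1) ^ 2) by apply pow2_ge_0. nra. }
assert (HdS : forall s, t0 <= s <= t0 + 10 ->
   is_derive S s (/ sqrt (2 * x s + 1) + eps * forcing a0 A ph s)).
{ intros s Hs; apply anomaly_derive, Hsol, Hs. }
(* As [|y| <= 1], the anomaly advances by at least [10 - 2 >= 2 * PI]. *)
assert (Ht1 : exists t1, t0 <= t1 <= t0 + 10 /\ S t1 = s0 + 2 * PI).
{ assert (He : s0 + 2 * PI <= S (t0 + 10)).
  { unfold S, s0. assert (H1 := Hy t0 ltac:(lra)).
    assert (H2 := Hy (t0 + 10) ltac:(lra)). lra. }
  destruct (Req_dec (S (t0 + 10)) (s0 + 2 * PI)) as [Heq | Hne].
  { exists (t0 + 10); split; [lra | assumption]. }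
  destruct (Ranalysis5.IVT_interv (fun t => S t - (s0 + 2 * PI)) t0 (t0 + 10))
    as (t & Ht & Hz); [| lra | | lra |].
  - intros t Ht. apply continuity_pt_minus; [| apply continuity_pt_const; intros ? ?; reflexivity].
    apply derivable_continuous_pt; eexists; apply is_derive_Reals, HdS, Ht.
  - change (S t0) with s0; lra.
  - exists t; split; [assumption | lra]. }
destruct Ht1 as (t1 & Ht1 & HS1).
exists t1; split; [assumption |].
set (d := 20 * P * Rabs eps).
assert (Hvar : forall s, t0 <= s <= t0 + 10 -> Rabs (X0 - X s) <= d /\ Rabs (Y0 - Y s) <= d).
{ intros s Hs.
  assert (Hd : 2 * P * Rabs eps * (s - t0) <= d).
  { unfold d. assert (0 <= P * Rabs eps) by (apply Rmult_le_pos; [assumption | apply Rabs_pos]).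
    nra. }
  assert (Hq : forall r z, Rabs z <= 2 -> Rabs (- eps * forcing a0 A ph r * z) <= 2 * P * Rabs eps).
  { intros r z Hz; rewrite !Rabs_mult, Rabs_Ropp.
    replace (2 * P * Rabs eps) with (Rabs eps * P * 2) by ring.
    apply Rmult_le_compat; [apply Rmult_le_pos; apply Rabs_pos | apply Rabs_pos | | assumption].
    apply Rmult_le_compat_l; [apply Rabs_pos | apply Hf]. }
  rewrite (Rabs_minus_sym X0), (Rabs_minus_sym Y0).
  split; apply Rle_trans with (2 := Hd).
  - apply (increment_le X (fun r => - eps * forcing a0 A ph r * (sin (S r) - Y r))); [lra | |].
    + intros r Hr; apply slow_x_derive, Hsol; lra.
    + intros r Hr; apply Hq.
      destruct (unit_disc_coordinates (X r) (Y r)) as [_ HY]; [apply Hn; lra |].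
      apply Rabs_le_between in HY; assert (Hb := SIN_bound (S r)); apply Rabs_le; lra.
  - apply (increment_le Y (fun r => - eps * forcing a0 A ph r * (cos (S r) + X r))); [lra | |].
    + intros r Hr; apply slow_y_derive, Hsol; lra.
    + intros r Hr; apply Hq, anomaly_factor_bound.
      apply (unit_disc_coordinates (X r) (Y r)), Hn; lra. }
assert (HX0 : X0 ^ 2 + Y0 ^ 2 <= 1) by (apply (Hn t0); lra).
set (k := drift a0 A X0 Y0).
assert (Hk : forall s, continuous k s) by (intros; unfold k, drift; smooth).
(* [- D] is [- Y] minus its predicted growth at the frozen slow position. *)
set (D := fun t => Y t + eps * RInt k s0 (S t)).
assert (HD0 : D t0 = Y0).
{ unfold D. change (S t0) with s0. rewrite RInt_point.
  change (Y0 + eps * 0 = Y0). ring. }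
replace (Y0 - slow_y ph t1 (x t1) (y t1) - eps * RInt k s0 (s0 + 2 * PI))
  with (- (D t1 - D t0)) by (rewrite HD0; unfold D; rewrite HS1; unfold Y; ring).
rewrite Rabs_Ropp.
set (M := P ^ 2 * (380 / m + 6) * eps ^ 2).
assert (HM : 0 <= M).
{ unfold M. assert (0 < 380 / m) by (apply Rdiv_lt_0_compat; lra).
  apply Rmult_le_pos; [apply Rmult_le_pos; [apply pow2_ge_0 | lra] | apply pow2_ge_0]. }
apply Rle_trans with (M * (t1 - t0)).
2:{ unfold turn_error. fold P.
  replace (10 * P ^ 2 * (380 / m + 6) * eps ^ 2) with (M * 10) by (unfold M; ring).
  apply Rmult_le_compat_l; [assumption | lra]. }
apply (increment_le D (fun r => - eps * forcing a0 A ph r * (cos (S r) + X r)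
   + eps * ((/ sqrt (2 * x r + 1) + eps * forcing a0 A ph r) * k (S r)))); [lra | |].
- intros r Hr. apply (is_derive_plus Y (fun t => eps * RInt k s0 (S t))).
  + apply slow_y_derive, Hsol; lra.
  + apply (is_derive_scal (fun t => RInt k s0 (S t)) r eps).
    apply (is_derive_comp (fun z => RInt k s0 z) S r); [| apply HdS; lra].
    apply (is_derive_RInt k _ s0 (S r)); [| apply Hk].
    exists (mkposreal 1 Rlt_0_1); intros z _.
    apply (RInt_correct (V := R_CompleteNormedModule)), continuous_ex_RInt, Hk.
- intros r Hr.
  destruct (Hsol r) as (Hmot & Hmu & _); [lra |].
  set (u := sqrt (2 * x r + 1)) in *.
  set (p := forcing a0 A ph r).
  (* The drift at the current slow position is the exact rate. *)
  assert (Hp : p * (cos (S r) + X r) = drift a0 A (X r) (Y r) (S r) / u).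
  { unfold drift.
    assert (Hu := slow_radius ph r (x r) (y r)). fold u in Hu.
    assert (Ht := slow_kepler ph r (x r) (y r)).
    fold (X r) in Hu, Ht; fold (Y r) in Hu, Ht.
    change (y r + r - ph) with (S r) in Hu, Ht.
    rewrite <- Hu, <- Ht. unfold p, forcing. field. lra. }
  replace (- eps * p * (cos (S r) + X r) + eps * ((/ u + eps * p) * k (S r)))
    with (eps * ((k (S r) - drift a0 A (X r) (Y r) (S r)) * / u + eps * (p * k (S r)))).
  2:{ replace (- eps * p * (cos (S r) + X r)) with (- eps * (p * (cos (S r) + X r))) by ring.
      rewrite Hp; field; lra. }
  assert (H1 : Rabs ((k (S r) - drift a0 A (X r) (Y r) (S r)) * / u) <= 19 * P * d * / m).
  { rewrite Rabs_mult. destruct (Hvar r) as [HvX HvY]; [lra |].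
    apply Rmult_le_compat; try apply Rabs_pos.
    - apply drift_variation; try assumption. apply Hn; lra.
    - rewrite Rabs_pos_eq by (left; apply Rinv_0_lt_compat; lra).
      apply Rinv_le_contravar; assumption. }
  assert (H2 : Rabs (eps * (p * k (S r))) <= Rabs eps * (P * (6 * P))).
  { rewrite !Rabs_mult. apply Rmult_le_compat_l; [apply Rabs_pos |].
    apply Rmult_le_compat; try apply Rabs_pos; [apply Hf | apply drift_bound; assumption]. }
  rewrite Rabs_mult.
  replace M with (Rabs eps * (19 * P * d * / m + Rabs eps * (P * (6 * P)))).
  2:{ unfold M, d. rewrite <- (pow2_abs eps). field. lra. }
  apply Rmult_le_compat_l; [apply Rabs_pos |].
  apply Rle_trans with (1 := Rabs_triang _ _); lra.
Qed.

(** * Global solutions of Lipschitz differential equations *)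

(** Time is clamped to [0 <= t <= T], so that bounds obtained on this interval are
    uniform on the whole line. *)
Definition picard {V : CompleteNormedModule R_AbsRing} (G : R -> V -> V) (T : R)
  (z0 : V) (X : R -> V) (t : R) : V :=
  plus z0 (RInt (fun s => G s (X s)) 0 (Rmax 0 (Rmin t T))).

Fixpoint picard_iter {V : CompleteNormedModule R_AbsRing} (G : R -> V -> V) (T : R)
  (z0 : V) (n : nat) : R -> V :=
  match n with
  | O => fun _ => z0
  | S n => picard G T z0 (picard_iter G T z0 n)
  end.

Lemma continuous_clamp (T t : R) : continuous (fun t => Rmax 0 (Rmin t T)) t.
Proof.
apply continuity_pt_filterlim.
apply (continuity_pt_ext (fun t => (0 + ((t + T - Rabs (t - T)) / 2)
   + Rabs (0 - (t + T - Rabs (t - T)) / 2)) / 2)).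
- intros z.
  assert (E : (z + T - Rabs (z - T)) / 2 = Rmin z T).
  { unfold Rmin, Rabs; destruct Rle_dec, Rcase_abs; lra. }
  rewrite E; unfold Rmax, Rabs; destruct Rle_dec, Rcase_abs; lra.
- reg.
Qed.

Lemma clamp_bounds (T t : R) : 0 <= T -> 0 <= Rmax 0 (Rmin t T) <= T.
Proof. intros; unfold Rmax, Rmin; repeat destruct Rle_dec; lra. Qed.

Lemma clamp_id (T t : R) : 0 <= t <= T -> Rmax 0 (Rmin t T) = t.
Proof. intros; unfold Rmax, Rmin; repeat destruct Rle_dec; lra. Qed.

Lemma minus_plus_cancel_l {G : AbelianGroup} (a b c : G) :
  minus (plus a b) (plus a c) = minus b c.
Proof.
unfold minus; rewrite opp_plus, (plus_comm a b), <- plus_assoc.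
rewrite (plus_assoc a), plus_opp_r, plus_zero_l; reflexivity.
Qed.

Section Picard.
Context {V : CompleteNormedModule R_AbsRing} (G : R -> V -> V) (L T : R) (z0 : V).
Hypothesis (HL : 0 < L) (HT : 0 <= T).
Hypothesis Hcont : forall X : R -> V, (forall t : R, continuous X t) ->
  forall t : R, continuous (fun s => G s (X s)) t.
Hypothesis Hlip : forall s a b, norm (minus (G s a) (G s b)) <= L * norm (minus a b).

Let clamp t := Rmax 0 (Rmin t T).
Let Xn := picard_iter G T z0.

Lemma continuous_field_RInt (X : R -> V) : (forall t : R, continuous X t) ->
  forall a b, ex_RInt (fun s => G s (X s)) a b.
Proof. intros HX a b; apply ex_RInt_continuous; intros; apply Hcont, HX. Qed.

Lemma derive_field_RInt (X : R -> V) : (forall t : R, continuous X t) ->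
  forall t, is_derive (fun t => plus z0 (RInt (fun s => G s (X s)) 0 t)) t (G t (X t)).
Proof.
intros HX t.
rewrite <- (plus_zero_l (G t (X t))).
apply @is_derive_plus; [apply @is_derive_const |].
apply (is_derive_RInt (fun s => G s (X s)) _ 0 t); [| apply Hcont, HX].
exists (mkposreal 1 Rlt_0_1); intros z _.
apply RInt_correct, continuous_field_RInt, HX.
Qed.

Lemma continuous_picard (X : R -> V) : (forall t : R, continuous X t) ->
  forall t : R, continuous (picard G T z0 X) t.
Proof.
intros HX t.
apply (continuous_comp (fun t => Rmax 0 (Rmin t T))
  (fun t => plus z0 (RInt (fun s => G s (X s)) 0 t))).
- apply continuous_clamp.
- apply (@ex_derive_continuous R_AbsRing V).
  eexists; apply derive_field_RInt, HX.
Qed.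

Lemma continuous_picard_iter (n : nat) : forall t : R, continuous (Xn n) t.
Proof.
induction n as [|n IH]; intros t.
- apply continuous_const.
- apply continuous_picard, IH.
Qed.

(** The Lipschitz bound integrated: with [g] an exponential of rate [2 L], the
    Picard operator contracts by [1/2] in the weighted distance. *)
Lemma picard_contracts (X Y : R -> V) (g : R -> R) (t I : R) :
  (forall t : R, continuous X t) -> (forall t : R, continuous Y t) ->
  (forall s : R, 0 <= s <= clamp t -> L * norm (minus (X s) (Y s)) <= g s) ->
  is_RInt g 0 (clamp t) I ->
  norm (minus (picard G T z0 X t) (picard G T z0 Y t)) <= I.
Proof.
intros HX HY Hg HI.
assert (Hc := clamp_bounds T t HT). fold (clamp t) in Hc.
replace (minus (picard G T z0 X t) (picard G T z0 Y t))
  with (minus (RInt (fun s => G s (X s)) 0 (clamp t)) (RInt (fun s => G s (Y s)) 0 (clamp t))).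
2:{ symmetry; apply (minus_plus_cancel_l (G := V)). }
apply (norm_RInt_le (fun s => minus (G s (X s)) (G s (Y s))) g 0 (clamp t)); [lra | | | assumption].
- intros s Hs. apply Rle_trans with (1 := Hlip s _ _), Hg; assumption.
- apply (is_RInt_minus (V := V) (fun s => G s (X s)) (fun s => G s (Y s)));
    apply RInt_correct, continuous_field_RInt; assumption.
Qed.

Lemma picard_iter_geometric : exists K, 0 <= K /\ forall n t,
  norm (minus (Xn (S n) t) (Xn n t)) <= K * (/ 2) ^ n.
Proof.
set (h := fun t => norm (minus (Xn 1 t) (Xn 0 t))).
destruct (continuity_ab_maj h 0 T HT) as (tm & Hm & _).
{ intros t _. apply continuity_pt_filterlim.
  apply (continuous_comp (fun t => minus (Xn 1 t) (Xn 0 t)) norm).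
  - apply (continuous_minus (V := V) (Xn 1) (Xn 0)); apply continuous_picard_iter.
  - apply (filterlim_norm (V := V)). }
set (C := h tm). assert (HC : 0 <= C) by apply norm_ge_0.
assert (Hgeo : forall n t, norm (minus (Xn (S n) t) (Xn n t)) <=
   C * (/ 2) ^ n * exp (2 * L * clamp t)).
{ induction n as [|n IH]; intros t.
  - assert (H : norm (minus (Xn 1 t) (Xn 0 t)) = h (clamp t)).
    { unfold h, Xn; simpl; unfold picard.
      unfold clamp; rewrite (clamp_id T (Rmax 0 _)) by (apply clamp_bounds, HT). reflexivity. }
    rewrite H.
    assert (h (clamp t) <= C) by (apply Hm, clamp_bounds, HT).
    assert (He : 1 <= exp (2 * L * clamp t)).
    { rewrite <- exp_0. destruct (clamp_bounds T t HT) as [Hc _].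
      assert (Hl : 0 <= 2 * L * clamp t) by (apply Rmult_le_pos; [lra | exact Hc]).
      destruct Hl as [Hl | Hl]; [left; apply exp_increasing, Hl | rewrite <- Hl; lra]. }
    unfold pow; nra.
  - set (D := C * (/ 2) ^ S n).
    assert (HD : 0 <= D) by (apply Rmult_le_pos; [assumption | apply pow_le; lra]).
    apply Rle_trans with (minus (D * exp (2 * L * clamp t)) (D * exp (2 * L * 0))).
    2:{ unfold minus, plus, opp; simpl. assert (H := exp_pos (2 * L * 0)). nra. }
    apply (picard_contracts (Xn (S n)) (Xn n) (fun s => D * (2 * L * exp (2 * L * s))));
      [apply continuous_picard_iter | apply continuous_picard_iter | |].
    + intros s Hs. specialize (IH s). unfold clamp in IH. rewrite clamp_id in IH.
      2:{ assert (Hb := clamp_bounds T t HT). fold (clamp t) in Hb. lra. }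
      replace (D * (2 * L * exp (2 * L * s))) with (L * (C * (/ 2) ^ n * exp (2 * L * s)))
        by (unfold D; rewrite <- tech_pow_Rmult; field).
      apply Rmult_le_compat_l; [lra | exact IH].
    + apply (is_RInt_derive (V := R_CompleteNormedModule) (fun s => D * exp (2 * L * s))).
      * intros s _; auto_derive; auto; ring.
      * intros s _. apply (@ex_derive_continuous R_AbsRing R_NormedModule); auto_derive; auto. }
exists (C * exp (2 * L * T)); split.
{ apply Rmult_le_pos; [assumption | left; apply exp_pos]. }
intros n t; apply Rle_trans with (1 := Hgeo n t).
replace (C * exp (2 * L * T) * (/ 2) ^ n) with (C * (/ 2) ^ n * exp (2 * L * T)) by ring.
apply Rmult_le_compat_l; [apply Rmult_le_pos; [assumption | apply pow_le; lra] |].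
destruct (clamp_bounds T t HT) as [_ [Hc | Hc]]; fold (clamp t) in Hc.
- left; apply exp_increasing; nra.
- rewrite Hc; lra.
Qed.

Lemma picard_iter_cauchy (K : R) :
  (forall n t, norm (minus (Xn (S n) t) (Xn n t)) <= K * (/ 2) ^ n) ->
  forall n p t, norm (minus (Xn (n + p) t) (Xn n t)) <= 2 * K * (/ 2) ^ n * (1 - (/ 2) ^ p).
Proof.
intros HK n p t; induction p as [|p IH].
- rewrite Nat.add_0_r.
  apply Rle_trans with 0; [right | unfold pow; lra].
  transitivity (norm (V := V) zero); [| apply (norm_zero (V := V))].
  apply f_equal, (minus_eq_zero (G := V)).
- replace (n + S p)%nat with (S (n + p)) by lia.
  replace (minus (Xn (S (n + p)) t) (Xn n t))
    with (plus (minus (Xn (S (n + p)) t) (Xn (n + p) t)) (minus (Xn (n + p) t) (Xn n t)))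
    by (symmetry; apply minus_trans).
  apply Rle_trans with (1 := norm_triangle (V := V) _ _).
  assert (H := HK (n + p)%nat t). rewrite pow_add in H.
  replace ((/ 2) ^ S p) with (/ 2 * (/ 2) ^ p) by reflexivity.
  lra.
Qed.

(** The iterates converge uniformly; the limit [X] is a fixed point.  The solution is
    the primitive without the clamp, which is differentiable on both sides at [0]
    and at [T]. *)
Theorem cauchy_lipschitz : exists X : R -> V, X 0 = z0 /\
  forall t, 0 <= t <= T -> is_derive X t (G t (X t)).
Proof.
destruct picard_iter_geometric as (K & HK0 & HK).
assert (HC := picard_iter_cauchy K HK).
assert (Hpow : is_lim_seq (fun n => 2 * K * (/ 2) ^ n) 0).
{ replace (Finite 0) with (Finite (2 * K * 0)) by (f_equal; ring).
  apply (is_lim_seq_scal_l _ (2 * K) 0), is_lim_seq_geom; rewrite Rabs_pos_eq; lra. }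
assert (Hunif : exists X : (@fct_CompleteSpace R V), 
  filterlim (Xn : nat -> @fct_CompleteSpace R V)
   eventually (locally X)).
{ apply filterlim_locally_cauchy. intros eps.
  destruct (proj1 (filterlim_locally _ _) Hpow (pos_div_2 eps)) as [N HN].
  exists (fun n => (N <= n)%nat); split; [exists N; auto |].
  assert (Hb : forall n t, (N <= n)%nat -> ball (Xn N t) (eps / 2) (Xn n t)).
  { intros n t Hn; apply (norm_compat1 (V := V)).
    replace n with (N + (n - N))%nat by lia.
    apply Rle_lt_trans with (1 := HC _ _ _).
    specialize (HN N (Nat.le_refl N)).
    unfold ball in HN; simpl in HN; unfold AbsRing_ball, abs, minus, plus, opp in HN; simpl in HN.
    apply Rabs_lt_between in HN.
    assert (0 <= (/ 2) ^ (n - N)) by (apply pow_le; lra).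
    assert (0 <= 2 * K * (/ 2) ^ N) by (apply Rmult_le_pos; [lra | apply pow_le; lra]).
    nra. }
  intros u v Hu Hv t.
  rewrite <- (Rplus_half_diag eps).
  apply ball_triangle with (Xn N t); [apply ball_sym |]; auto. }
destruct Hunif as [X HX].
assert (HXc : forall t : R, continuous X t).
{ intros t.
  apply (filterlim_switch_1 eventually _ (locally t) _ Xn X (fun n => Xn n t) (X t)).
  - exact HX.
  - intros n; apply continuous_picard_iter.
  - apply filterlim_locally; intros eps.
    assert (H := proj1 (filterlim_locally _ _) HX eps).
    apply filter_imp with (2 := H); intros n Hn; apply Hn. }
assert (Hfix : forall t, X t = picard G T z0 X t).
{ intros t.
  apply (filterlim_locally_unique (V := V) (F := eventually) (fun n => Xn (S n) t)).
  - apply filterlim_locally; intros eps.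
    destruct (proj1 (filterlim_locally _ _) HX eps) as [N HN].
    exists N; intros n Hn; apply HN; lia.
  - apply (filterlim_locally_ball_norm (U := V)); intros eps.
    assert (Hf := norm_factor_gt_0 (V := V)).
    assert (HLT : 0 <= L * T) by (apply Rmult_le_pos; lra).
    assert (Hden : 0 < norm_factor (V := V) * (L * T + 1)) by (apply Rmult_lt_0_compat; lra).
    set (eta := mkposreal _ (Rdiv_lt_0_compat _ _ (cond_pos eps) Hden)).
    assert (H := proj1 (filterlim_locally _ _) HX eta).
    apply filter_imp with (2 := H); intros n Hn.
    unfold ball_norm; set (e := eps / (L * T + 1)).
    assert (He : 0 < e) by (apply Rdiv_lt_0_compat; [apply cond_pos | lra]).
    apply Rle_lt_trans with (scal (clamp t - 0) (L * e)).
    + apply (picard_contracts (Xn n) X (fun _ => L * e));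
        [apply continuous_picard_iter | exact HXc | | apply @is_RInt_const].
      intros s _; apply Rmult_le_compat_l; [lra |]; left.
      replace e with (norm_factor (V := V) * eta) by (unfold e, eta; simpl; field; lra).
      apply (norm_compat2 (V := V)), Hn.
    + unfold scal; simpl; unfold mult; simpl.
      destruct (clamp_bounds T t HT) as [Hc0 Hc]; fold (clamp t) in Hc0, Hc.
      replace (pos eps) with (L * T * e + e) by (unfold e; field; lra).
      assert (0 < L * e) by (apply Rmult_lt_0_compat; lra). nra. }
exists (fun t => plus z0 (RInt (fun s => G s (X s)) 0 t)).
assert (He : forall t, 0 <= t <= T -> plus z0 (RInt (fun s => G s (X s)) 0 t) = X t).
{ intros t Ht; rewrite (Hfix t); unfold picard; rewrite (clamp_id T t Ht); reflexivity. }
split.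
- rewrite RInt_point; apply plus_zero_r.
- intros t Ht; rewrite He by assumption; apply derive_field_RInt, HXc.
Qed.
End Picard.

(** * Cutoff, confinement and escape *)

Lemma continuous_pair (f g : R -> R) (t : R) :
  continuous f t -> continuous g t ->
  continuous (fun s => (f s, g s) : R * R) t.
Proof.
intros Hf Hg; apply filterlim_locally; intros eps.
assert (Hf' := proj1 (filterlim_locally _ _) Hf eps).
assert (Hg' := proj1 (filterlim_locally _ _) Hg eps).
apply filter_imp with (2 := filter_and _ _ Hf' Hg').
intros s [H1 H2]; split; assumption.
Qed.

(** The force, frozen below [2 x + 1 = delta] so as to be globally Lipschitz. *)
Definition cutoff_force (delta x : R) : R := -1 + 1 / sqrt (Rmax (2 * x + 1) delta).

Lemma cutoff_force_eq (delta x : R) : delta <= 2 * x + 1 ->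
  cutoff_force delta x = -1 + 1 / sqrt (2 * x + 1).
Proof. intros H; unfold cutoff_force; rewrite Rmax_left by assumption; reflexivity. Qed.

Lemma cutoff_force_lipschitz (delta : R) : 0 < delta ->
  exists L, 0 < L /\ forall x y,
    Rabs (cutoff_force delta x - cutoff_force delta y) <= L * Rabs (x - y).
Proof.
intros Hd; set (r := sqrt delta).
assert (Hr : 0 < r) by (apply sqrt_lt_R0; assumption).
exists (/ r ^ 3); split; [apply Rinv_0_lt_compat, pow_lt, Hr |].
intros x y; unfold cutoff_force.
set (a := Rmax (2 * x + 1) delta); set (b := Rmax (2 * y + 1) delta).
assert (Ha : r <= sqrt a) by apply sqrt_le_1_alt, Rmax_r.
assert (Hb : r <= sqrt b) by apply sqrt_le_1_alt, Rmax_r.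
assert (Hab : Rabs (b - a) <= 2 * Rabs (x - y)).
{ unfold a, b, Rmax, Rabs; repeat destruct Rle_dec; repeat destruct Rcase_abs; lra. }
assert (Ea : sqrt a ^ 2 = a) by (apply pow2_sqrt; apply Rle_trans with (2 := Rmax_r _ _); lra).
assert (Eb : sqrt b ^ 2 = b) by (apply pow2_sqrt; apply Rle_trans with (2 := Rmax_r _ _); lra).
set (u := sqrt a) in *; set (v := sqrt b) in *.
replace (-1 + 1 / u - (-1 + 1 / v)) with ((b - a) * / (u * v * (u + v)))
  by (rewrite <- Ea, <- Eb; field; lra).
assert (Hp : 2 * r ^ 3 <= u * v * (u + v)).
{ replace (2 * r ^ 3) with (r * r * (r + r)) by ring.
  apply Rmult_le_compat; try nra. }
assert (Hr3 : 0 < r ^ 3) by (apply pow_lt, Hr).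
rewrite Rabs_mult, (Rabs_pos_eq (/ _)) by (left; apply Rinv_0_lt_compat; lra).
apply Rle_trans with (2 * Rabs (x - y) * / (2 * r ^ 3)); [| right; field; lra].
apply Rmult_le_compat; [apply Rabs_pos | left; apply Rinv_0_lt_compat; lra | assumption |].
apply Rinv_le_contravar; lra.
Qed.

Lemma continuous_lipschitz (f : R -> R) (L t : R) : 0 < L ->
  (forall x y, Rabs (f x - f y) <= L * Rabs (x - y)) -> continuous f t.
Proof.
intros HL Hf; apply filterlim_locally; intros eps.
exists (mkposreal _ (Rdiv_lt_0_compat _ _ (cond_pos eps) HL)); intros y Hy.
change (Rabs (f y - f t) < eps). change (Rabs (y - t) < eps / L) in Hy.
apply Rle_lt_trans with (1 := Hf y t).
apply Rmult_lt_compat_l with (r := L) in Hy; [| assumption].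
replace (L * (eps / L)) with (pos eps) in Hy by (field; lra). assumption.
Qed.

Lemma is_derive_fst (z : R -> R * R) (t : R) (l : R * R) :
  is_derive z t l -> is_derive (fun s => fst (z s)) t (fst l).
Proof.
intros H. apply (filterdiff_comp' (U := R_NormedModule)
  (V := prod_NormedModule R_AbsRing R_NormedModule R_NormedModule)
  (W := R_NormedModule) z fst t (fun h => scal h l) fst); [exact H |].
apply filterdiff_linear, is_linear_fst.
Qed.

Lemma is_derive_snd (z : R -> R * R) (t : R) (l : R * R) :
  is_derive z t l -> is_derive (fun s => snd (z s)) t (snd l).
Proof.
intros H. apply (filterdiff_comp' (U := R_NormedModule)
  (V := prod_NormedModule R_AbsRing R_NormedModule R_NormedModule)
  (W := R_NormedModule) z snd t (fun h => scal h l) snd); [exact H |].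
apply filterdiff_linear, is_linear_snd.
Qed.

Lemma cutoff_solution (p : R -> R) (eps delta T x0 y0 : R) :
  (forall s : R, continuous p s) -> 0 < delta -> 0 <= T ->
  exists x y : R -> R, x 0 = x0 /\ y 0 = y0 /\ forall t, 0 <= t <= T ->
    is_derive x t (y t) /\ is_derive y t (cutoff_force delta (x t) + eps * p t).
Proof.
intros Hp Hdelta HT.
destruct (cutoff_force_lipschitz delta Hdelta) as (L & HL & Hlip).
set (G := fun (s : R) (z : R * R) => (snd z, cutoff_force delta (fst z) + eps * p s) : R * R).
(* The plane is complete as the space of complex numbers. *)
destruct (cauchy_lipschitz (V := C_R_CompleteNormedModule) G (1 + L) T (x0, y0))
  as (Z & HZ0 & HZ);
  [lra | assumption | | |].
- intros Z HZ t; apply continuous_pair.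
  + apply (continuous_comp Z snd); [apply HZ | apply continuous_snd].
  + apply (continuous_plus (V := R_NormedModule)
      (fun s => cutoff_force delta (fst (Z s))) (fun s => eps * p s)).
    * apply (continuous_comp (fun s => fst (Z s)) (cutoff_force delta)).
      -- apply (continuous_comp Z fst); [apply HZ | apply continuous_fst].
      -- apply continuous_lipschitz with L; assumption.
    * apply (continuous_scal_r (V := R_NormedModule) eps p), Hp.
- intros s [x y] [x' y'].
  change (sqrt (Rabs (y - y') ^ 2 + Rabs (cutoff_force delta x + eps * p s
            - (cutoff_force delta x' + eps * p s)) ^ 2)
     <= (1 + L) * sqrt (Rabs (x - x') ^ 2 + Rabs (y - y') ^ 2)).
  replace (cutoff_force delta x + eps * p s - (cutoff_force delta x' + eps * p s))
    with (cutoff_force delta x - cutoff_force delta x') by ring.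
  assert (Hf := Hlip x x').
  assert (Ha := Rabs_pos (x - x')). assert (Hb := Rabs_pos (y - y')).
  assert (Hc := Rabs_pos (cutoff_force delta x - cutoff_force delta x')).
  set (a := Rabs (x - x')) in *; set (b := Rabs (y - y')) in *.
  set (c := Rabs (cutoff_force delta x - cutoff_force delta x')) in *.
  rewrite <- (sqrt_pow2 (1 + L)) by lra.
  rewrite <- sqrt_mult_alt by apply pow2_ge_0.
  apply sqrt_le_1_alt.
  assert (c ^ 2 <= (L * a) ^ 2) by (apply pow_incr; lra).
  assert (0 <= (1 + 2 * L) * a ^ 2) by (apply Rmult_le_pos; [lra | apply pow2_ge_0]).
  assert (0 <= (2 * L + L ^ 2) * b ^ 2) by (apply Rmult_le_pos; [nra | apply pow2_ge_0]).
  nra.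
- exists (fun t => fst (Z t)), (fun t => snd (Z t)).
  rewrite HZ0; split; [reflexivity |]; split; [reflexivity |].
  intros t Ht; split.
  + apply (is_derive_fst Z t (G t (Z t))), HZ, Ht.
  + apply (is_derive_snd Z t (G t (Z t))), HZ, Ht.
Qed.

(** Cover [K] by the open sublevel sets of levels below [M]. *)
Lemma compact_lt_uniform {T : UniformSpace} (K : T -> Prop) (f : T -> R) (M : R) :
  compact_set K -> (forall z, continuous f z) -> (forall z, K z -> f z < M) ->
  exists q, q < M /\ forall z, K z -> f z <= q.
Proof.
intros HK Hf HM.
destruct (HK {q : R | q < M} (fun q z => f z < proj1_sig q)) as [l Hl].
- intros q. apply (open_comp f (fun v => v < proj1_sig q)); [intros; apply Hf | apply open_lt].
- intros z Hz; specialize (HM z Hz).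
  assert (Hq : (f z + M) / 2 < M) by lra.
  exists (exist (fun q => q < M) _ Hq); simpl; lra.
- assert (Hb : exists q, q < M /\ forall i, In i l -> proj1_sig i <= q).
  { clear Hl; induction l as [|i l [q [Hq IH]]].
    - exists (M - 1); split; [lra | intros i []].
    - exists (Rmax (proj1_sig i) q); split.
      + apply Rmax_lub_lt; [apply (proj2_sig i) | assumption].
      + intros j [<- | Hj]; [apply Rmax_l |].
        apply Rle_trans with (2 := Rmax_r _ _), IH, Hj. }
  destruct Hb as (q & Hq & Hb); exists q; split; [assumption |].
  intros z Hz; destruct (Hl z Hz) as (i & Hi & Hfi); specialize (Hb i Hi); lra.
Qed.

(** Twice the energy, i.e. the squared radius [X^2 + Y^2] in the slow plane. *)
Definition kepler_energy (z : R * R) : R :=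
  (sqrt (2 * fst z + 1) - 1) ^ 2 + snd z ^ 2.

Lemma continuous_kepler_energy (z : R * R) : continuous kepler_energy z.
Proof.
assert (Hp : forall v : R, continuous (fun v => v ^ 2) v) by (intros; smooth).
unfold kepler_energy.
apply (continuous_plus (V := R_NormedModule)
  (fun z => (sqrt (2 * fst z + 1) - 1) ^ 2) (fun z => snd z ^ 2)).
- apply (continuous_comp (fun z : R * R => sqrt (2 * fst z + 1) - 1) (fun v => v ^ 2)); [| apply Hp].
  apply (continuous_comp (fun z : R * R => sqrt (2 * fst z + 1)) (fun v => v - 1)); [| smooth].
  apply (continuous_comp (fun z : R * R => 2 * fst z + 1) sqrt); [| apply continuous_sqrt].
  apply (continuous_comp (fun z : R * R => fst z) (fun v => 2 * v + 1)); [| smooth].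
  apply continuous_fst.
- apply (continuous_comp (fun z : R * R => snd z) (fun v => v ^ 2)); [| apply Hp].
  apply continuous_snd.
Qed.

Lemma period_annulus_energy (z : R * R) : period_annulus z -> kepler_energy z < 1.
Proof.
intros [Hx HV]; unfold kepler_energy, V in *.
assert (Hs : sqrt (2 * fst z + 1) ^ 2 = 2 * fst z + 1) by (apply pow2_sqrt; lra).
nra.
Qed.

(** The radius is bounded on [K] by some [r < 1], and [u >= 1 - r]. *)
Lemma compact_away_from_collision (K : R * R -> Prop) :
  compact_set (T := prod_UniformSpace R_UniformSpace R_UniformSpace) K ->
  (forall z, K z -> period_annulus z) ->
  exists m, 0 < m /\ forall z, K z ->
    m <= sqrt (2 * fst z + 1) /\ kepler_energy z <= 1.
Proof.
intros HK Hsub.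
destruct (compact_lt_uniform K kepler_energy 1 HK continuous_kepler_energy)
  as (q & Hq & Hle).
{ intros z Hz; apply period_annulus_energy, Hsub, Hz. }
set (r := Rmax q 0).
assert (Hr : 0 <= r < 1) by (unfold r, Rmax; destruct Rle_dec; lra).
assert (Hs : 0 <= sqrt r < 1).
{ split; [apply sqrt_pos |]. rewrite <- sqrt_1; apply sqrt_lt_1_alt; assumption. }
exists (1 - sqrt r); split; [lra |].
intros z Hz; specialize (Hle z Hz); split; [| lra].
assert (Hqr : q <= r) by apply Rmax_l.
assert (Hr2 : sqrt r ^ 2 = r) by (apply pow2_sqrt; lra).
unfold kepler_energy in Hle. assert (0 <= snd z ^ 2) by apply pow2_ge_0.
apply Rnot_lt_le; intros Hlt. nra.
Qed.

(** At the supremum of the times up to which [b <= g], continuity gives [b <= g]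
    still, hence [a < g] for a little longer, while values below [b] occur
    arbitrarily soon afterwards. *)
Lemma first_exit (g : R -> R) (a b T : R) : a < b -> b <= g 0 ->
  (forall t : R, 0 <= t <= T -> continuous g t) ->
  (forall t, 0 <= t <= T -> b <= g t) \/
  exists t, 0 < t <= T /\ g t < b /\ forall s, 0 <= s <= t -> a < g s.
Proof.
intros Hab H0 Hc.
destruct (classic (forall t, 0 <= t <= T -> b <= g t)) as [H | H]; [left; exact H | right].
apply not_all_ex_not in H; destruct H as [t H].
apply imply_to_and in H; destruct H as [Ht Hgt]; apply Rnot_le_lt in Hgt.
set (E := fun e => 0 <= e <= t /\ forall s, 0 <= s <= e -> b <= g s).
destruct (completeness E) as [e [He1 He2]].
{ exists t; intros e [He _]; lra. }
{ exists 0; split; [lra |]. intros s Hs; replace s with 0 by lra; assumption. }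
assert (Het : e <= t) by (apply He2; intros z [Hz _]; lra).
assert (He0 : 0 <= e).
{ apply He1; split; [lra |]. intros s Hs; replace s with 0 by lra; assumption. }
assert (HeT : 0 <= e <= T) by lra.
assert (Hlt : forall s, 0 <= s < e -> b <= g s).
{ intros s Hs; apply Rnot_lt_le; intros Hgs.
  assert (e <= s); [| lra]. apply He2; intros z [Hz Hz'].
  apply Rnot_lt_le; intros Hsz. assert (b <= g s) by (apply Hz'; lra). lra. }
assert (Hge : b <= g e).
{ apply Rnot_lt_le; intros Hge.
  assert (Hpos : 0 < b - g e) by lra.
  destruct (proj1 (filterlim_locally _ _) (Hc e HeT) (mkposreal _ Hpos)) as [eta Heta].
  assert (He0' : e <> 0) by (intros Hz; rewrite Hz in Hge; lra).
  assert (Heta0 := cond_pos eta).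
  set (s := Rmax 0 (e - eta / 2)).
  assert (Hs : 0 <= s < e /\ e - eta / 2 <= s) by (unfold s, Rmax; destruct Rle_dec; lra).
  assert (Hb : Rabs (g s - g e) < b - g e).
  { apply Heta. change (Rabs (s - e) < eta). apply Rabs_lt_between; lra. }
  apply Rabs_lt_between in Hb. assert (b <= g s) by (apply Hlt; lra). lra. }
assert (Hle : forall s, 0 <= s <= e -> b <= g s).
{ intros s [Hs1 [Hs2 | Hs2]]; [apply Hlt; lra | rewrite Hs2; assumption]. }
assert (Het' : e < t) by (destruct Het as [?|Heq]; [assumption | rewrite Heq in Hge; lra]).
assert (Hpos : 0 < g e - a) by lra.
destruct (proj1 (filterlim_locally _ _) (Hc e HeT) (mkposreal _ Hpos)) as [eta Heta].
assert (Heta0 := cond_pos eta).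
set (t' := Rmin t (e + eta / 2)).
assert (Ht' : e < t' <= t /\ t' <= e + eta / 2) by (unfold t', Rmin; destruct Rle_dec; lra).
assert (Hex : exists s, 0 <= s <= t' /\ g s < b).
{ apply NNPP; intros Hno. assert (t' <= e); [| lra].
  apply He1; split; [lra |]. intros s Hs; apply Rnot_lt_le; intros Hgs.
  apply Hno; exists s; split; assumption. }
destruct Hex as (s & Hs & Hgs). exists s.
assert (Hse : e < s) by (apply Rnot_le_lt; intros Hse; assert (b <= g s) by (apply Hle; lra); lra).
split; [lra |]; split; [assumption |].
intros z Hz. destruct (Rle_dec z e) as [Hze | Hze].
- assert (b <= g z) by (apply Hle; lra). lra.
- assert (Hb : Rabs (g z - g e) < g e - a).
  { apply Heta. change (Rabs (z - e) < eta). apply Rabs_lt_between; lra. }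
  apply Rabs_lt_between in Hb; lra.
Qed.

(** Each turn in the confined region moves [Y] by at least [c0 |eps|] in the
    direction given by the sign of [eps], and [Y] stays between [-1] and [1].  A turn takes
    time at most [10], so [10 N] leaves room for [N] turns. *)
Lemma confinement_time_bound (a0 A ph eps m c0 : R) (N : nat) (x y : R -> R) :
  0 <= A -> 0 < m -> 0 < c0 -> c0 <= A * bessel_slope - 3 / 2 * Rabs a0 ->
  turn_error a0 A m * Rabs eps <= c0 ->
  (forall s, 0 <= s <= 10 * INR N ->
     motion_at eps (forcing a0 A ph s) x y s /\ m <= sqrt (2 * x s + 1) /\
     kepler_energy (x s, y s) <= 1) ->
  INR N * (c0 * Rabs eps) <= 2.
Proof.
intros HA Hm Hc0 Hmean Herr Hsol.
set (Y := fun t => slow_y ph t (x t) (y t)).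
assert (Hn : forall s, 0 <= s <= 10 * INR N ->
   slow_x ph s (x s) (y s) ^ 2 + Y s ^ 2 <= 1).
{ intros s Hs; unfold Y; rewrite slow_norm; apply Hsol, Hs. }
set (sg := if Rle_dec 0 eps then 1 else -1).
assert (Hsg : eps = sg * Rabs eps /\ (sg = 1 \/ sg = -1)).
{ unfold sg, Rabs; destruct Rle_dec, Rcase_abs; split; try lra; auto. }
destruct Hsg as [Heps Hsg].
assert (Hgain : forall n, (n <= N)%nat -> exists t, 0 <= t <= 10 * INR n /\
   INR n * (c0 * Rabs eps) <= sg * (Y 0 - Y t)).
{ induction n as [|n IH]; intros Hle.
  - exists 0; simpl; split; [lra | right; ring].
  - destruct IH as (t0 & Ht0 & Hg); [lia |].
    assert (HnN : INR n + 1 <= INR N) by (rewrite <- S_INR; apply le_INR, Hle).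
    destruct (drift_one_turn a0 A ph eps m t0 x y HA Hm) as (t1 & Ht1 & He).
    { intros s Hs; apply Hsol; lra. }
    exists t1; rewrite S_INR; split; [lra |].
    assert (HI := mean_drift_ge a0 A (slow_x ph t0 (x t0) (y t0)) (slow_y ph t0 (x t0) (y t0))
      (y t0 + t0 - ph) HA (Hn t0 ltac:(lra))).
    set (I := RInt _ _ _ : R) in *.
    assert (HPI := PI2_1).
    assert (HI2 : 2 * c0 <= I) by nra.
    fold (Y t0) in He; fold (Y t1) in He.
    assert (Habs := Rabs_pos eps).
    assert (Hsq : turn_error a0 A m * eps ^ 2 <= c0 * Rabs eps).
    { rewrite <- (pow2_abs eps). replace (turn_error a0 A m * Rabs eps ^ 2)
        with (turn_error a0 A m * Rabs eps * Rabs eps) by ring.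
      apply Rmult_le_compat_r; assumption. }
    assert (Hlow : sg * (Y t0 - Y t1 - eps * I) >= - (c0 * Rabs eps)).
    { apply Rabs_le_between in He. destruct Hsg as [-> | ->]; lra. }
    assert (Hmain : sg * (eps * I) >= 2 * c0 * Rabs eps).
    { replace (sg * (eps * I)) with (Rabs eps * I).
      - assert (0 <= Rabs eps * (I - 2 * c0)) by (apply Rmult_le_pos; lra). lra.
      - rewrite Heps at 2. destruct Hsg as [-> | ->]; ring. }
    lra. }
destruct (Hgain N (Nat.le_refl N)) as (t & Ht & Hg).
assert (H0 : 0 <= 10 * INR N) by lra.
destruct (unit_disc_coordinates _ _ (Hn 0 ltac:(lra))) as [_ HY0].
destruct (unit_disc_coordinates _ _ (Hn t ltac:(lra))) as [_ HYt].
apply Rabs_le_between in HY0; apply Rabs_le_between in HYt.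
destruct Hsg as [Hs | Hs]; rewrite Hs in Hg; lra.
Qed.

(** The resonance condition, after taking square roots. *)
Lemma averaged_gap_pos (a0 A : R) : 0 <= A ->
  A ^ 2 > 9 * a0 ^ 2 / (4 * bessel_slope ^ 2) -> 0 < A * bessel_slope - 3 / 2 * Rabs a0.
Proof.
intros HA H. assert (Hb := bessel_slope_pos).
assert (Hb2 : 0 < 4 * bessel_slope ^ 2) by (assert (0 < bessel_slope ^ 2) by (apply pow_lt, Hb); lra).
apply Rgt_lt, (Rlt_div_l _ _ _ Hb2) in H.
rewrite <- (pow2_abs a0) in H. assert (Ha := Rabs_pos a0).
apply Rnot_le_lt; intros Hle.
assert (HAb : 0 <= A * bessel_slope) by (apply Rmult_le_pos; lra).
assert (Hsq : (2 * (A * bessel_slope)) ^ 2 <= (3 * Rabs a0) ^ 2) by (apply pow_incr; lra).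
replace ((2 * (A * bessel_slope)) ^ 2) with (A ^ 2 * (4 * bessel_slope ^ 2)) in Hsq by ring.
replace ((3 * Rabs a0) ^ 2) with (9 * Rabs a0 ^ 2) in Hsq by ring.
lra.
Qed.

Theorem corollary2p2 (a0 a1 b1 : R)
  (hab : a1 ^ 2 + b1 ^ 2 > 9 * a0 ^ 2 / (4 * (BesselJ 1 1 - BesselJ 2 1) ^ 2)) :
  resonant_on_compact_subsets (fun t : R => a0 + a1 * cos t + b1 * sin t).
Proof.
intros K HK _ Hsub d Hd.
destruct (polar_coordinates a1 b1) as (A & ph & HA & HA2 & Ha1 & Hb1).
rewrite <- bessel_slope_eq, <- HA2 in hab.
set (c0 := A * bessel_slope - 3 / 2 * Rabs a0).
assert (Hc0 : 0 < c0) by (apply averaged_gap_pos; assumption).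
destruct (compact_away_from_collision K HK Hsub) as (m & Hm & HKm).
assert (Herr : 0 <= turn_error a0 A m).
{ unfold turn_error. assert (0 < 380 / m) by (apply Rdiv_lt_0_compat; lra).
  apply Rmult_le_pos; [| lra]. apply Rmult_le_pos; [lra | apply pow2_ge_0]. }
assert (Hforce : forall t, a0 + a1 * cos t + b1 * sin t = forcing a0 A ph t).
{ intros t; unfold forcing; rewrite cos_minus, Ha1, Hb1; ring. }
exists (c0 / (turn_error a0 A m + 1)); split; [apply Rdiv_lt_0_compat; lra |].
intros eps [Heps0 Heps] c Hdisc.
assert (Hsmall : turn_error a0 A m * Rabs eps <= c0).
{ apply Rlt_div_r in Heps; lra. }
assert (HcB : open_disc c (d / 2) c).
{ unfold open_disc, dist_euc. rewrite !Rminus_diag.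
  rewrite Rsqr_0, Rplus_0_l, sqrt_0. lra. }
assert (Hgain : 0 < c0 * Rabs eps) by (apply Rmult_lt_0_compat; assumption).
(* [N] turns are more than a confined solution can make. *)
destruct (nfloor_ex (2 / (c0 * Rabs eps))) as (n & _ & Hn).
{ apply Rdiv_le_0_compat; lra. }
set (N := S n).
assert (HN : 2 < INR N * (c0 * Rabs eps)).
{ unfold N; rewrite S_INR. apply Rlt_div_l in Hn; lra. }
assert (HT : 0 <= 10 * INR N) by (assert (H := pos_INR N); lra).
destruct (cutoff_solution (forcing a0 A ph) eps (m ^ 2 / 2) (10 * INR N) (fst c) (snd c))
  as (x & y & Hx0 & Hy0 & Hsol).
{ intros s; unfold forcing; smooth. }
{ assert (0 < m ^ 2) by (apply pow_lt, Hm). lra. }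
{ assumption. }
assert (Hm2 : forall z, K z -> m ^ 2 <= 2 * fst z + 1).
{ intros z Hz; destruct (HKm z Hz) as [Hu _]. destruct (Hsub z Hz) as [Hz1 _].
  rewrite <- (pow2_sqrt (2 * fst z + 1)) by lra. apply pow_incr; lra. }
assert (Hm20 : 0 < m ^ 2) by (apply pow_lt, Hm).
assert (Htrue : forall t, t <= 10 * INR N ->
  (forall s, 0 <= s <= t -> m ^ 2 / 2 < 2 * x s + 1) ->
  solves_on (fun t => a0 + a1 * cos t + b1 * sin t) eps t x y).
{ intros t Ht Habove s Hs. specialize (Habove s Hs).
  destruct (Hsol s ltac:(lra)) as [Hdx Hdy].
  rewrite cutoff_force_eq in Hdy by lra. rewrite <- Hforce in Hdy.
  split; [lra | split; assumption]. }
assert (Hstart : (x 0, y 0) = c) by (rewrite Hx0, Hy0; symmetry; apply surjective_pairing).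
assert (Hx : m ^ 2 <= 2 * x 0 + 1) by (rewrite Hx0; apply Hm2, Hdisc, HcB).
assert (Hleave : forall t, t <= 10 * INR N ->
  (forall s, 0 <= s <= t -> m ^ 2 / 2 < 2 * x s + 1) -> ~ K (x t, y t) ->
  flow_not_within (fun t => a0 + a1 * cos t + b1 * sin t) eps t (open_disc c (d / 2)) K).
{ intros t Ht Habove Hout; exists x, y; rewrite Hstart.
  split; [assumption | split; [apply Htrue; assumption | assumption]]. }
(* Either the solution drops below the level [m^2], which [K] lies above, while
   still above the cutoff level, or the cutoff is never active. *)
destruct (first_exit (fun t => 2 * x t + 1) (m ^ 2 / 2) (m ^ 2) (10 * INR N))
  as [Hin | (t & Ht & Hout & Habove)]; [lra | assumption | | |].
{ intros t Ht. apply (@ex_derive_continuous R_AbsRing R_NormedModule).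
  auto_derive. eexists; apply Hsol, Ht. }
2:{ exists t; split; [lra |]. apply Hleave; [lra | assumption |].
    intros HKt; apply Hm2 in HKt; simpl in HKt; lra. }
apply NNPP; intros Hno.
assert (Hconf : forall t, 0 <= t <= 10 * INR N -> K (x t, y t)).
{ intros t [[Ht0 | Ht0] Ht].
  - apply NNPP; intros Hout; apply Hno; exists t; split; [assumption |].
    apply Hleave; try assumption. intros s Hs; specialize (Hin s ltac:(lra)); lra.
  - rewrite <- Ht0, Hstart; apply Hdisc, HcB. }
assert (Hbound := confinement_time_bound a0 A ph eps m c0 N x y HA Hm Hc0 (Rle_refl _) Hsmall).
apply Rlt_not_le in HN; apply HN, Hbound.
intros s Hs. specialize (HKm _ (Hconf s Hs)).
split; [| exact HKm].
rewrite <- Hforce. apply (Htrue (10 * INR N)); [lra | | assumption].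
intros r Hr; specialize (Hin r Hr); lra.
Qed.
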